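(* For every category of partitions $\mathcal C$ with $\langle\emptyset\rangle\subseteq\mathcal C\subseteq\mathcal I_\emptyset$ there exists a subsemigroup $D$ of $(\mathbb N_0,+)$ such that $\mathcal C=\mathcal I_D$. In particular, $\langle\emptyset\rangle=\mathcal I_{\mathbb N_0}$.
   Context: A (two-colored) partition $p$ consists of two finite totally ordered sets $U$ (upper row, left to right) and $L$ (lower row), a decomposition of $U\sqcup L$ (the points) into non-empty pairwise disjoint blocks, and a coloring of each point by $\circ$ or $\bullet$. A pair partition has only two-point blocks. Operations: tensor product $p\otimes p'$ (append the rows of $p'$ to the right of those of $p$); involution $p^*$ (exchange the rows); composition $pp'$, defined when the lower row of $p'$ and the upper row of $p$ agree in length and coloring: put $p'$ on top of $p$, identify the lower row of $p'$ with the upper row of $p$, keep the upper row of $p'$ and lower row of $p$, and let two remaining points be in the same block iff connected through blocks of $p,p'$ via the middle points (components entirely in the middle are discarded). A category of partitions is a set of partitions closed under these three operations and containing the partitions with one upper and one lower point of equal color $c\in\{\circ,\bullet\}$ forming a block, and the partitions with empty upper row and lower row $\circ\bullet$ resp. $\bullet\circ$ forming a block. $\langle\mathcal G\rangle$ is the smallest category containing $\mathcal G$. On the points of $p$ consider the cyclic order obtained by traversing the lower row left to right and then the upper row right to left. $]\alpha,\beta[$: points strictly after $\alpha$ and before $\beta$ in this cyclic order; $]\alpha,\beta]:=]\alpha,\beta[\cup\{\beta\}$ for $\alpha\ne\beta$, $]\alpha,\alpha]:=\emptyset$. Normalized color: the color for lower points, the opposite color for upper points. $\sigma_p(S)$ =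 #normalized-$\circ$ points of $S$ $-$ #normalized-$\bullet$ points of $S$. Distinct blocks $B,B'$ cross if there are $\alpha,\beta\in B,\gamma,\delta\in B'$ in cyclic order $\alpha,\gamma,\beta,\delta$. $\mathcal P^{\circ\bullet}_{2,\mathrm{nb}}$: pair partitions each block of which has one point of each normalized color. $\mathcal S_0$: those $p\in\mathcal P^{\circ\bullet}_{2,\mathrm{nb}}$ with $\sigma_p(]\alpha,\beta[)=0$ for all blocks $\{\alpha,\beta\}$. For $p\in\mathcal S_0$: $\delta_p(\alpha,\beta)=\sigma_p(]\alpha,\beta[)$ for different normalized colors, $\sigma_p(]\alpha,\beta])$ for equal ones; $d_p(B,B')=|\delta_p(\alpha,\alpha')|$ for any $\alpha\in B,\alpha'\in B'$ (well defined). A subsemigroup of $(\mathbb N_0,+)$ is a possibly empty subset closed under addition. $\mathcal I_D$: all $p\in\mathcal S_0$ with $d_p(B,B')\notin D$ for all crossing blocks $B,B'$. (Note $\mathcal I_\emptyset=\mathcal S_0$.) *)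

(* Defs.v *)
From mathcomp Require Import all_boot all_algebra.
From Stdlib Require Import Relations.
Set Implicit Arguments. Unset Strict Implicit. Unset Printing Implicit Defensive.
Import GRing.Theory Num.Theory.

(* Colors: false = white (circle), true = black (bullet). *)

(* A raw partition: upper row colors (left to right), lower row colors
   (left to right), and block labels.  Points are indexed
   0 .. m-1 (upper row, left to right) then m .. m+n-1 (lower row, left to
   right).  The label of a point is the smallest index of a point in its
   block (canonical representation of the decomposition into blocks). *)
Record rawpart := RawPart { rup : seq bool; rlo : seq bool; rlab : seq nat }.

Definition wfp (p : rawpart) : bool :=
  (size (rlab p) == size (rup p) + size (rlo p)) &&
  all (fun i => (nth 0 (rlab p) i <= i) &&
                (nth 0 (rlab p) (nth 0 (rlab p) i) == nth 0 (rlab p) i))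
      (iota 0 (size (rlab p))).

Definition part := {p : rawpart | wfp p}.

Definition up (p : part) := rup (val p).
Definition lo (p : part) := rlo (val p).

Inductive pt := U of nat | L of nat.

Definition valid (p : part) (x : pt) : bool :=
  match x with U i => i < size (up p) | L j => j < size (lo p) end.
Definition idx (p : part) (x : pt) : nat :=
  match x with U i => i | L j => size (up p) + j end.
Definition lab (p : part) (x : pt) : nat := nth 0 (rlab (val p)) (idx p x).
Definition color (p : part) (x : pt) : bool :=
  match x with U i => nth false (up p) i | L j => nth false (lo p) j end.

Definition sameblock (p : part) (x y : pt) : Prop :=
  valid p x /\ valid p y /\ lab p x = lab p y.

Definition has_blocks (q : part) (R : pt -> pt -> Prop) : Prop :=
  forall x y, sameblock q x y <-> (valid q x /\ valid q y /\ R x y).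

Definition tside (p : part) (x : pt) : bool * pt :=
  match x with
  | U i => if i < size (up p) then (false, U i) else (true, U (i - size (up p)))
  | L j => if j < size (lo p) then (false, L j) else (true, L (j - size (lo p)))
  end.

Definition is_tensor (p p' q : part) : Prop :=
  up q = up p ++ up p' /\ lo q = lo p ++ lo p' /\
  has_blocks q (fun x y =>
    (tside p x).1 = (tside p y).1 /\
    (if (tside p x).1 then sameblock p' (tside p x).2 (tside p y).2
     else sameblock p (tside p x).2 (tside p y).2)).

Definition swap (x : pt) : pt := match x with U i => L i | L j => U j end.

Definition is_inv (p q : part) : Prop :=
  up q = lo p /\ lo q = up p /\
  has_blocks q (fun x y => sameblock p (swap x) (swap y)).

Inductive cpt := Top of pt | Bot of pt.

(* edges of the graph on the points of p' (Top) and of p (Bot), where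
   the lower row of p' is identified with the upper row of p *)
Definition cedge (p p' : part) (a b : cpt) : Prop :=
  match a, b with
  | Top x, Top y => sameblock p' x y
  | Bot x, Bot y => sameblock p x y
  | Top (L j), Bot (U j') => j = j' /\ j < size (lo p')
  | Bot (U j), Top (L j') => j = j' /\ j < size (up p)
  | _, _ => False
  end.

Definition cemb (x : pt) : cpt := match x with U i => Top (U i) | L j => Bot (L j) end.

Definition is_comp (p p' q : part) : Prop :=
  lo p' = up p /\ up q = up p' /\ lo q = lo p /\
  has_blocks q (fun x y => clos_refl_trans cpt (cedge p p') (cemb x) (cemb y)).

Definition idp (c : bool) : part :=
  exist _ (RawPart [:: c] [:: c] [:: 0; 0]) isT.
Definition pairp (c : bool) : part :=
  exist _ (RawPart [::] [:: c; ~~ c] [:: 0; 0]) isT.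

Definition category (C : part -> Prop) : Prop :=
  (forall c, C (idp c)) /\ (forall c, C (pairp c)) /\
  (forall p p' q, C p -> C p' -> is_tensor p p' q -> C q) /\
  (forall p p' q, C p -> C p' -> is_comp p p' q -> C q) /\
  (forall p q, C p -> is_inv p q -> C q).

Definition gen (G : part -> Prop) (p : part) : Prop :=
  forall C, category C -> (forall q, G q -> C q) -> C p.

(* ---- cyclic order: positions 0..k-1, lower row left to right, then
   upper row right to left ---- *)
Definition npts (p : part) : nat := size (up p) + size (lo p).

Definition ptat (p : part) (t : nat) : pt :=
  if t < size (lo p) then L t else U ((size (up p)).-1 - (t - size (lo p))).

Definition ncol (p : part) (t : nat) : bool :=
  match ptat p t with
  | L j => color p (L j)
  | U i => ~~ color p (U i)
  end.

Definition plab (p : part) (t : nat) : nat := lab p (ptat p t).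

Definition sigma (p : part) (S : pred nat) : int :=
  (\sum_(t < npts p | S t) (if ncol p t then -1 else 1))%R.

Definition openI (a b : nat) : pred nat := fun t =>
  if a < b then (a < t) && (t < b)
  else if b < a then (a < t) || (t < b)
  else t != a.
Definition hoI (a b : nat) : pred nat := fun t =>
  (a != b) && (openI a b t || (t == b)).

Definition P2nb (p : part) : Prop :=
  (forall t, t < npts p -> count (fun u => plab p u == plab p t) (iota 0 (npts p)) = 2)
  /\ (forall u v, u < npts p -> v < npts p -> u != v -> plab p u = plab p v ->
        ncol p u != ncol p v).

Definition S0 (p : part) : Prop :=
  P2nb p /\
  (forall a b, a < npts p -> b < npts p -> a != b -> plab p a = plab p b ->
     sigma p (openI a b) = 0%R).

Definition delta (p : part) (a b : nat) : int :=
  if ncol p a != ncol p b then sigma p (openI a b) else sigma p (hoI a b).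

(* I_D : for crossing blocks B (containing a,b) and B' (containing c,d) with
   cyclic order a,c,b,d, we require d_p(B,B') = |delta_p(a,c)| not in D. *)
Definition I_ (D : nat -> Prop) (p : part) : Prop :=
  S0 p /\
  (forall a b c d, a < npts p -> b < npts p -> c < npts p -> d < npts p ->
     plab p a = plab p b -> plab p c = plab p d -> plab p a != plab p c ->
     a != b -> openI a b c -> openI b a d ->
     ~ D (absz (delta p a c))).

Definition subsemigroup (D : nat -> Prop) : Prop :=
  forall x y, D x -> D y -> D (x + y).

(* Main.v *)
Require Import Defs.
From mathcomp Require Import all_boot all_algebra.
From mathcomp Require Import zify.
From Stdlib Require Import Relations Classical.
Set Implicit Arguments. Unset Strict Implicit. Unset Printing Implicit Defensive.
Import GRing.Theory Num.Theory.

(* Read a partition cyclically as a word in letters (normalized colour, block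
   label) and let a white letter be a step up and a black one a step down.  Then
   S_0 says that every block joins an up-step to a down-step at the same level,
   and d_p(B, B') is the difference of the levels of B and B'.  In this form
   the category operations are rotation, concatenation, reversal and the
   contraction of two adjacent letters of opposite colour.

   Given C, let D be the set of distances that do not occur between crossing
   blocks of members of C.  If B and B' cross at distance a + b, then the word
   passes, between a point of B and a point of B', through the level at distance
   a from B; as the path must cross this level, some block at this level leaves
   the interval, hence crosses B at distance a or B' at distance b.  So D is a
   subsemigroup.

   Conversely let p be in I_D.  Induct on the length of p.  Two adjacent letters
   of opposite colour belong to blocks x and y of the same level; contracting
   them leaves a shorter word, in C by induction, from which p is recovered by
   pulling one end of a string through a word A lying under a chord.  This
   requires a member of C containing a chord over A, with A wired as in p.
   A chord over the colours of A, in which every letter at an occurring distance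
   leaves A, is assembled letter by letter from members of C; the wiring of A in
   p is then restored by composing with A A^{-1}, where the blocks inside A are
   doubled.  That word is in I_D, and it is shorter than p, hence in C, if the
   chord is chosen so that A lies on its shorter side. *)

(** * Words and classes of words *)

(* A letter is a pair (normalized colour, block label); [true] is black. *)
Notation letter := (bool * nat)%type.
Notation word := (seq letter).

Definition flip (e : letter) : letter := (~~ e.1, e.2).
(** As a path, the same walk traversed backwards. On cyclic words it is the involution of
    partitions, and it is how the upper row enters a cyclic word. *)
Definition winv (s : word) : word := rev [seq flip e | e <- s].
Definition ren (f : nat -> nat) (s : word) : word := [seq (e.1, f e.2) | e <- s].
Definition labs (s : word) : seq nat := [seq e.2 | e <- s].
Definition cols (s : word) : seq bool := [seq e.1 | e <- s].
Definition subst (x y l : nat) : nat := if l == y then x else l.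

Lemma flipK : involutive flip.
Proof. by case=> c l; rewrite /flip /= negbK. Qed.

Lemma inv_cat s t : winv (s ++ t) = winv t ++ winv s.
Proof. by rewrite /winv map_cat rev_cat. Qed.

Lemma inv_cons e s : winv (e :: s) = winv s ++ [:: flip e].
Proof. by rewrite -cat1s inv_cat. Qed.

Lemma inv_rcons s e : winv (rcons s e) = flip e :: winv s.
Proof. by rewrite -cats1 inv_cat. Qed.

Lemma invK : involutive winv.
Proof. by move=> s; rewrite /winv map_rev revK mapK //; exact: flipK. Qed.

Lemma mem_inv e s : (e \in winv s) = (flip e \in s).
Proof.
rewrite /winv mem_rev; apply/mapP/idP => [[f fs ->]|fs]; first by rewrite flipK.
by exists (flip e); rewrite ?flipK.
Qed.

Lemma labs_cat s t : labs (s ++ t) = labs s ++ labs t.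
Proof. exact: map_cat. Qed.

Lemma labs_cons e s : labs (e :: s) = e.2 :: labs s.
Proof. by []. Qed.

Lemma sub_labs s t : {subset s <= t} -> {subset labs s <= labs t}.
Proof. by move=> st l /mapP [e /st et ->]; apply/mapP; exists e. Qed.

Lemma labs_inv s : labs (winv s) = rev (labs s).
Proof. by rewrite /labs /winv map_rev -map_comp. Qed.

Lemma mem_labs_inv l s : (l \in labs (winv s)) = (l \in labs s).
Proof. by rewrite labs_inv mem_rev. Qed.

Lemma cols_cat s t : cols (s ++ t) = cols s ++ cols t.
Proof. exact: map_cat. Qed.

Lemma cols_ren f s : cols (ren f s) = cols s.
Proof. by rewrite /cols /ren -map_comp. Qed.

Lemma labs_ren f s : labs (ren f s) = map f (labs s).
Proof. by rewrite /labs /ren -!map_comp. Qed.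

Lemma ren_cat f s t : ren f (s ++ t) = ren f s ++ ren f t.
Proof. exact: map_cat. Qed.

Lemma ren_cons f e s : ren f (e :: s) = (e.1, f e.2) :: ren f s.
Proof. by []. Qed.

Lemma ren_inv f s : ren f (winv s) = winv (ren f s).
Proof. by rewrite /ren /winv map_rev -!map_comp. Qed.

Lemma ren_comp f g s : ren f (ren g s) = ren (f \o g) s.
Proof. by rewrite /ren -map_comp. Qed.

Lemma ren_id_in f s : {in labs s, f =1 id} -> ren f s = s.
Proof.
move=> fE; rewrite -[RHS]map_id; apply/eq_in_map => -[c l] ls /=.
by rewrite fE //; apply/mapP; exists (c, l).
Qed.

Lemma eq_ren_in f g s : {in labs s, f =1 g} -> ren f s = ren g s.
Proof.
move=> fE; apply/eq_in_map => -[c l] ls /=.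
by rewrite fE //; apply/mapP; exists (c, l).
Qed.

Lemma mem_labs (e : letter) s : e \in s -> e.2 \in labs s.
Proof. by move=> es; apply/mapP; exists e. Qed.

Lemma ren_letter f (e : letter) s : e \in s -> (e.1, f e.2) \in ren f s.
Proof. by move=> es; apply/mapP; exists e. Qed.

Lemma size_ren f s : size (ren f s) = size s.
Proof. exact: size_map. Qed.

Lemma size_inv s : size (winv s) = size s.
Proof. by rewrite size_rev size_map. Qed.

Definition fresh (s : word) : nat := (foldr maxn 0 (labs s)).+1.

Lemma freshP s l : l \in labs s -> l < fresh s.
Proof.
rewrite /fresh; elim: (labs s) => //= a t IH; rewrite inE ltnS.
by case/orP => [/eqP->|/IH]; rewrite leq_max ?leqnn // ltnS => ->; rewrite orbT.
Qed.

Lemma fresh_notin s : fresh s \notin labs s.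
Proof. by apply/negP => /freshP; rewrite ltnn. Qed.

Lemma subst_id x l : subst x x l = l.
Proof. by rewrite /subst; case: eqP => // ->. Qed.

(** The category operations seen on cyclic words. By [w_ren] only the block structure matters;
    [w_contract] is composition with a cap on two adjacent points, whose blocks are merged. *)
Record wclass (W : word -> Prop) : Prop := WClass {
  w_ren : forall f s, {in labs s &, injective f} -> W s -> W (ren f s);
  w_rot : forall e s, W (e :: s) -> W (rcons s e);
  w_cat : forall s t, (forall l, l \in labs s -> l \notin labs t) ->
    W s -> W t -> W (s ++ t);
  w_contract : forall c x y s1 s2, W (s1 ++ (c, x) :: (~~ c, y) :: s2) ->
    W (ren (subst x y) (s1 ++ s2));
  w_inv : forall s, W s -> W (winv s);
  w_base : forall c x, W [:: (c, x); (~~ c, x)] }.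

Lemma w_rotn W (HW : wclass W) s t : W (s ++ t) -> W (t ++ s).
Proof.
elim: s t => [|e s IH] t; first by rewrite cats0.
by move=> /(w_rot HW); rewrite rcons_cat => /IH; rewrite cat_rcons.
Qed.

Lemma w_nil W (HW : wclass W) : W [::].
Proof. exact: (w_contract HW (s1 := [::]) (s2 := [::]) (w_base HW false 0)). Qed.

(** Labels are only names, so a renaming matters through its kernel alone. The map [h] with
    [h (f l) = g l] is well defined and injective on the labels of [ren f s]. *)
Lemma w_ker W (HW : wclass W) (f g : nat -> nat) s :
  {in labs s &, forall l l', f l = f l' <-> g l = g l'} ->
  W (ren f s) -> W (ren g s).
Proof.
move=> H Ws.
pose h m := g (nth 0 (labs s) (find (fun l => f l == m) (labs s))).
have hE : {in labs s, forall l, h (f l) = g l}.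
  move=> l ls; rewrite /h; set k := find _ _.
  have hk : has (fun l0 => f l0 == f l) (labs s) by apply/hasP; exists l.
  apply/(H _ _ _ ls); first by rewrite mem_nth // -has_find.
  by apply/eqP; apply: (nth_find 0 hk).
have -> : ren g s = ren h (ren f s).
  by rewrite ren_comp; apply: eq_ren_in => l ls /=; rewrite hE.
apply: (w_ren HW) => // m m'; rewrite labs_ren => /mapP [l ls ->] /mapP [l' ls' ->].
by rewrite !hE // => /(H _ _ ls ls').
Qed.

Lemma w_insert_word W (HW : wclass W) s1 s2 t :
  (forall l, l \in labs (s1 ++ s2) -> l \notin labs t) ->
  W (s1 ++ s2) -> W t -> W (s1 ++ t ++ s2).
Proof.
move=> dis W12 Wt; rewrite catA; apply: (w_rotn HW); rewrite catA.
apply: (w_cat HW) => //; last exact: (w_rotn HW).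
by move=> l; rewrite labs_cat mem_cat orbC -mem_cat -labs_cat => /dis.
Qed.

Lemma w_insert W (HW : wclass W) c x s1 s2 :
  x \notin labs (s1 ++ s2) ->
  W (s1 ++ s2) -> W (s1 ++ (c, x) :: (~~ c, x) :: s2).
Proof.
move=> xs W12; apply: (w_insert_word HW (t := [:: (c, x); (~~ c, x)])) => //.
  move=> l ls; rewrite /labs /= !inE orbb; apply: contraNneq xs => <-.
  exact: ls.
exact: (w_base HW).
Qed.

Lemma w_contract1 W (HW : wclass W) c x s1 s2 :
  W (s1 ++ (c, x) :: (~~ c, x) :: s2) -> W (s1 ++ s2).
Proof.
move=> /(w_contract HW); rewrite ren_id_in // => l _; exact: subst_id.
Qed.

(* By the condition on [E], [G] identifies no more labels than the contraction forces. *)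
Lemma w_zip W (HW : wclass W) X B B' Y :
  cols B = cols B' -> W (X ++ B ++ winv B' ++ Y) ->
  exists G : nat -> nat,
    [/\ W (ren G X ++ ren G Y), map G (labs B) = map G (labs B') &
      forall E : nat -> nat -> Prop,
        (forall l, E l l) -> (forall l m, E l m -> E m l) ->
        (forall l m n, E l m -> E m n -> E l n) ->
        (forall k, k < size B -> E (nth 0 (labs B) k) (nth 0 (labs B') k)) ->
        forall l l', G l = G l' -> E l l'].
Proof.
have [n nB] := ubnP (size B).
elim: n X B B' Y nB => // n IH X B B' Y.
(* In [B ++ winv B'] the last letters of the two words are adjacent and of opposite colour, so
   zipping consumes both from the right. *)
case/lastP: B => [|B [c x]] nB.
  case: B' => // _ WXY; exists id; split=> //.
    rewrite !ren_id_in //.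
  by move=> E Er _ _ _ l l' ->.
case/lastP: B' => [|B' [c' y]].
  by move/(congr1 size); rewrite !size_map size_rcons.
rewrite /cols !map_rcons => /rcons_inj [cB /= <-] {c'}.
rewrite inv_rcons /flip /= -cats1 -!catA /= catA => /(w_contract HW).
rewrite !ren_cat -catA ren_inv; set r := subst x y.
case/IH => [||G [WG GB GE]].
- by rewrite size_ren; move: nB; rewrite size_rcons.
- by rewrite !cols_ren.
exists (G \o r); split.
- by move: WG; rewrite !ren_comp.
- rewrite -?cats1 !labs_cat !map_cat /=; congr (_ ++ _).
    by move: GB; rewrite !labs_ren -!map_comp.
  by rewrite /r /subst eqxx; case: eqP => // ->.
move=> E Er Es Et + l l' /= Gl; rewrite cats1 => EB.
have sB : size B' = size B.
  by rewrite -(size_map fst B) -(size_map fst B') cB.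
have Exy : E x y.
  have := EB (size B); rewrite size_rcons ltnS leqnn => /(_ isT).
  by rewrite /labs !map_rcons !nth_rcons !size_map sB ltnn eqxx.
have Er' m : E (r m) m.
  by rewrite /r /subst; case: eqP => // ->.
have E2 : E (r l) (r l').
  apply: (GE E) => // k; rewrite size_ren => kB; rewrite !labs_ren.
  rewrite !(nth_map 0) ?size_map ?sB //.
  apply: (Et _ _ _ (Er' _)); apply: (Es _ _); apply: (Et _ _ _ (Er' _)); apply: (Es _ _).
  have := EB k; rewrite size_rcons ltnS (ltnW kB) => /(_ isT).
  by rewrite /labs !map_rcons !nth_rcons !size_map sB kB.
by apply: (Et _ (r l)); [exact/Es | exact: (Et _ (r l'))].
Qed.

(** * Levels and crossings *)

Definition stepv (c : bool) : int := (if c then -1 else 1)%R.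
Definition hsum (cs : seq bool) : int := (\sum_(c <- cs) stepv c)%R.
(* A step between heights [i] and [i + 1] has level [i], whatever its direction. *)
Definition lv (h : int) (c : bool) : int := (if c then h - 1 else h)%R.

Fixpoint walk (lam : nat -> int) (h : int) (s : word) : bool :=
  if s is e :: s' then (lam e.2 == lv h e.1) && walk lam (h + stepv e.1)%R s'
  else true.

Definition flip_closed (s : word) : Prop := forall e, e \in s -> flip e \in s.

(* [lam] gives the level of each block; levels are determined up to the base height [h]. *)
Definition IW (D : nat -> Prop) (s : word) : Prop :=
  [/\ uniq s, flip_closed s &
    exists (lam : nat -> int) (h : int), walk lam h s /\
      forall x y, x != y -> subseq [:: x; y; x; y] (labs s) ->
        ~ D (absz (lam x - lam y)%R)].

Lemma stepvN c : stepv (~~ c) = (- stepv c)%R.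
Proof. by case: c. Qed.

Lemma hsum_cat s t : hsum (s ++ t) = (hsum s + hsum t)%R.
Proof. exact: big_cat. Qed.

Lemma hsum_cons c s : hsum (c :: s) = (stepv c + hsum s)%R.
Proof. exact: big_cons. Qed.

Lemma hsum_nil : hsum [::] = 0%R.
Proof. exact: big_nil. Qed.

Lemma cols_inv s : cols (winv s) = rev (map negb (cols s)).
Proof. by rewrite /cols /winv map_rev -!map_comp. Qed.

Lemma hsum_rev s : hsum (rev s) = hsum s.
Proof. by rewrite /hsum (perm_big s) // perm_rev. Qed.

Lemma hsum_inv s : hsum (cols (winv s)) = (- hsum (cols s))%R.
Proof.
rewrite cols_inv hsum_rev; elim: (cols s) => [|c t IH] /=.
  by rewrite hsum_nil oppr0.
by rewrite !hsum_cons IH stepvN opprD.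
Qed.

(** Flipping permutes the letters of [s] but negates the sum. *)
Lemma hsum_flip_closed s : uniq s -> flip_closed s -> hsum (cols s) = 0%R.
Proof.
move=> us fs.
have p : perm_eq (winv s) s.
  apply: uniq_perm => //; first by rewrite rev_uniq map_inj_uniq //; exact: inv_inj flipK.
  move=> e; rewrite mem_inv; apply/idP/idP => /fs //; by rewrite flipK.
have : hsum (cols (winv s)) = hsum (cols s) by apply: perm_big; apply: perm_map.
rewrite hsum_inv; lia.
Qed.

Lemma walk_cat lam h s t :
  walk lam h (s ++ t) = walk lam h s && walk lam (h + hsum (cols s))%R t.
Proof.
elim: s h => [|e s IH] h /=; first by rewrite hsum_nil addr0.
by rewrite IH hsum_cons addrA andbA.
Qed.

Lemma walk_ren lam f h s : walk lam h (ren f s) = walk (lam \o f) h s.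
Proof. by elim: s h => //= e s IH h; rewrite IH. Qed.

Lemma eq_walk lam lam' h s :
  {in labs s, lam =1 lam'} -> walk lam h s = walk lam' h s.
Proof.
elim: s h => //= e s IH h E; rewrite IH; last first.
  by move=> l ls; apply: E; rewrite inE ls orbT.
by rewrite E // inE eqxx.
Qed.

Lemma walk_shift lam d h s :
  walk (fun l => lam l + d)%R (h + d)%R s = walk lam h s.
Proof.
elim: s h => //= e s IH h; rewrite -(IH (h + stepv e.1)%R) addrAC; congr (_ && _).
by rewrite /lv; case: e.1 => /=; lia.
Qed.

(** A step and its reversal have the same level under [lv], so [lam] also serves the reversed
    path. *)
Lemma walk_inv lam h s :
  walk lam h s -> walk lam (h + hsum (cols s))%R (winv s).
Proof.
elim: s h => //= e s IH h /andP [le ws]; rewrite inv_cons walk_cat.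
rewrite hsum_cons addrA IH //= andbT hsum_inv addrK.
by move: le; rewrite /lv /flip; case: e.1 => /= /eqP->; lia.
Qed.

(** * Crossings under contraction *)

Lemma subseq_split (T : eqType) (t l1 l2 : seq T) : subseq t (l1 ++ l2) ->
  exists t1 t2, [/\ t = t1 ++ t2, subseq t1 l1 & subseq t2 l2].
Proof.
case/subseqP => m; rewrite size_cat => sm ->.
exists (mask (take (size l1) m) l1), (mask (drop (size l1) m) l2).
split; rewrite ?mask_subseq //.
rewrite -mask_cat ?cat_take_drop // size_takel // sm; exact: leq_addr.
Qed.

Lemma subseq4_split (T : eqType) (a b c d : T) l1 l2 :
  subseq [:: a; b; c; d] (l1 ++ l2) ->
  [\/ subseq [:: a; b; c; d] l2, subseq [:: a] l1 /\ subseq [:: b; c; d] l2,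
      subseq [:: a; b] l1 /\ subseq [:: c; d] l2 |
      subseq [:: a; b; c] l1 /\ subseq [:: d] l2
      \/ subseq [:: a; b; c; d] l1].
Proof.
case/subseq_split => [[|? [|? [|? [|? [|? t1]]]]]] [t2 []] //= [];
  do ?[move=> -> //]; move=> *; subst.
- by constructor 1.
- by constructor 2.
- by constructor 3.
- by constructor 4; left.
- by constructor 4; right.
Qed.

(** The two occurrences of [b] cut the circle into two arcs, one with [p] and one with [r]. The
    inserted [x] and [y] lie on the same arc; the one that equals the letter on the other arc
    crosses [b]. *)
Lemma cross_insert (x y b p r : nat) l1 l2 :
  x != y -> b != x -> b != y -> p \in [:: x; y] -> r \in [:: x; y] ->
  subseq [:: p; b; r; b] (l1 ++ l2) \/ subseq [:: b; p; b; r] (l1 ++ l2) ->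
  exists z, z \in [:: x; y] /\
    (subseq [:: z; b; z; b] (l1 ++ x :: y :: l2) \/
     subseq [:: b; z; b; z] (l1 ++ x :: y :: l2)).
Proof.
move=> xy bx byy px ry H.
have [xb yb yx] : [/\ x != b, y != b & y != x] by rewrite !(eq_sym _ b) (eq_sym y).
have E t1 t2 t : subseq t1 l1 -> subseq t2 l2 -> subseq t (t1 ++ x :: y :: t2) ->
    subseq t (l1 ++ x :: y :: l2).
  move=> s1 s2 s; apply: subseq_trans s _; apply: cat_subseq => //=.
  by rewrite !eqxx.
suff : [|| subseq [:: x; b; x; b] (l1 ++ x :: y :: l2),
           subseq [:: b; x; b; x] (l1 ++ x :: y :: l2),
           subseq [:: y; b; y; b] (l1 ++ x :: y :: l2) |
           subseq [:: b; y; b; y] (l1 ++ x :: y :: l2)].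
  by case/or4P => Hz; [exists x | exists x | exists y | exists y];
    rewrite !inE eqxx ?orbT; auto.
(* By monotonicity only the four letters of the pattern matter, which leaves finitely many words to
   be checked by computation. *)
have F t1 t2 : subseq t1 l1 -> subseq t2 l2 ->
    [|| subseq [:: x; b; x; b] (t1 ++ x :: y :: t2),
        subseq [:: b; x; b; x] (t1 ++ x :: y :: t2),
        subseq [:: y; b; y; b] (t1 ++ x :: y :: t2) |
        subseq [:: b; y; b; y] (t1 ++ x :: y :: t2)] ->
    [|| subseq [:: x; b; x; b] (l1 ++ x :: y :: l2),
        subseq [:: b; x; b; x] (l1 ++ x :: y :: l2),
        subseq [:: y; b; y; b] (l1 ++ x :: y :: l2) |
        subseq [:: b; y; b; y] (l1 ++ x :: y :: l2)].
  by move=> s1 s2 /or4P [] /(E _ _ _ s1 s2) ->; rewrite ?orbT.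
move: px ry; rewrite !inE => /orP [] /eqP Ep /orP [] /eqP Er; subst p r;
case: H => /subseq4_split [s2|[s1 s2]|[s1 s2]|[[s1 s2]|s1]];
  (apply: (F _ _ s1 s2) || apply: (F _ _ (sub0seq _) s2) || apply: (F _ _ s1 (sub0seq _)));
  by rewrite /= ?(negbTE xy, negbTE bx, negbTE byy, negbTE xb, negbTE yb, negbTE yx, eqxx) ?orbT.
Qed.

Lemma subseq_map_inv (f : nat -> nat) (t s : seq nat) :
  subseq t (map f s) -> exists t', t = map f t' /\ subseq t' s.
Proof.
case/subseqP => m; rewrite size_map => sm ->; exists (mask m s).
by rewrite map_mask mask_subseq.
Qed.

(** Crossings after a contraction are inherited. Two points of one block with different old labels
    can only come from the merged blocks, and then [cross_insert] finds an old block that was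
    crossed already. *)
Lemma cross_contract (x y a b : nat) l1 l2 : a != b ->
  subseq [:: a; b; a; b] (map (subst x y) (l1 ++ l2)) ->
  exists a' b', [/\ a' != b', subseq [:: a'; b'; a'; b'] (l1 ++ x :: y :: l2) &
    (subst x y a' = a /\ subst x y b' = b) \/ (subst x y a' = b /\ subst x y b' = a)].
Proof.
move=> ab /subseq_map_inv [t' []].
case: t' => [|p [|q [|r [|s [|? ?]]]]] //= [ap bq ar bs] H.
have incl t : subseq t (l1 ++ l2) -> subseq t (l1 ++ x :: y :: l2).
  move=> st; apply: subseq_trans st _; apply: cat_subseq => //.
  exact: (suffix_subseq [:: x; y]).
have xyP u v : u != v -> subst x y u = subst x y v ->
    [/\ x != y, u \in [:: x; y], v \in [:: x; y] & subst x y u = x].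
  move=> uv; rewrite !inE /subst.
  case: (eqVneq u y) => [uy|uy]; case: (eqVneq v y) => [vy|vy] => E.
  - by rewrite uy vy eqxx in uv.
  - by split; rewrite ?orbT ?E ?eqxx.
  - by split; rewrite ?orbT -?E ?eqxx.
  - by rewrite E eqxx in uv.
have out w : x != y -> subst x y w != x -> w != x /\ w != y.
  by rewrite /subst; case: (eqVneq w y) => // _; rewrite eqxx.
have [pr|pr] := eqVneq p r.
  subst r; have [qs|qs] := eqVneq q s.
    subst s; exists p, q; split; [|exact: incl|by left].
    by apply: contraNneq ab => E; rewrite ap bq E.
  have [xy qx sx qE] := xyP _ _ qs (etrans (esym bq) bs).
  have [px py] : p != x /\ p != y by apply: out => //; rewrite -ap -qE -bq.
  have [z [zx Hz]] := cross_insert xy px py qx sx (or_intror H).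
  have zb : subst x y z = b.
    by rewrite bq qE; move: zx; rewrite !inE /subst; do 2!case: eqP.
  have zp : z != p by apply: contraNneq ab => E; rewrite ap -zb E.
  case: Hz => Hz; [exists z, p | exists p, z]; split=> //; first by right.
    by rewrite eq_sym.
  by left.
have [xy px rx pE] := xyP _ _ pr (etrans (esym ap) ar).
have bx : b != x by rewrite -pE -ap eq_sym.
have [qx qy] : q != x /\ q != y by apply: out => //; rewrite -bq.
have [sx sy] : s != x /\ s != y by apply: out => //; rewrite -bs.
have qs : q = s by move: bq bs; rewrite /subst (negbTE qy) (negbTE sy) => <-.
subst s.
have [z [zx Hz]] := cross_insert xy qx qy px rx (or_introl H).
have za : subst x y z = a.
  by rewrite ap pE; move: zx; rewrite !inE /subst; do 2!case: eqP.
have zq : z != q by apply: contraNneq ab => E; rewrite bq -za E.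
case: Hz => Hz; [exists z, q | exists q, z]; split=> //; first by left.
  by rewrite eq_sym.
by right.
Qed.

(** * Closure of [IW D] under the word operations *)

Lemma walk_contract_level lam h c x y s1 s2 :
  walk lam h (s1 ++ (c, x) :: (~~ c, y) :: s2) -> lam x = lam y.
Proof.
rewrite walk_cat /= => /and4P [_ /eqP-> /eqP-> _].
by case: c; rewrite /lv /=; lia.
Qed.

Lemma walk_contract lam h c x y s1 s2 :
  walk lam h (s1 ++ (c, x) :: (~~ c, y) :: s2) ->
  walk lam h (ren (subst x y) (s1 ++ s2)).
Proof.
move=> w; have E := walk_contract_level w; rewrite walk_ren.
rewrite (eq_walk (lam' := lam)); last by move=> l _ /=; rewrite /subst; case: eqP => // ->.
move: w; rewrite !walk_cat /= => /and4P [-> _ _].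
by rewrite stepvN addrK.
Qed.

Lemma uniq_cat_pair (T : eqType) (a b : T) s1 s2 :
  uniq (s1 ++ a :: b :: s2) = [&& a != b, a \notin s1 ++ s2, b \notin s1 ++ s2 & uniq (s1 ++ s2)].
Proof.
rewrite -[a :: b :: s2]/([:: a; b] ++ s2) uniq_catCA /= !inE negb_or !mem_cat.
by rewrite -andbA.
Qed.

Lemma IW_contract D c x y s1 s2 :
  IW D (s1 ++ (c, x) :: (~~ c, y) :: s2) -> IW D (ren (subst x y) (s1 ++ s2)).
Proof.
case=> us fs [lam [h [ws cs]]].
have mem e : (e \in s1 ++ (c, x) :: (~~ c, y) :: s2) =
    [|| e == (c, x), e == (~~ c, y) | e \in s1 ++ s2].
  by rewrite !mem_cat !inE; do !case: (_ == _); do !case: (_ \in _).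
move: (us); rewrite uniq_cat_pair => /and4P [_ nx ny us'].
(* Only the partner [(c, y)] of a contracted letter is renamed; it becomes [(c, x)], replacing the
   contracted letter of that name. *)
have ren0 e : e \in s1 ++ s2 -> (e.1, subst x y e.2) =
    if e == (c, y) then (c, x) else e.
  move=> es; case: e es => b l es; rewrite xpair_eqE /subst /=.
  case: (eqVneq l y) es => [-> es|_]; last by rewrite andbF.
  rewrite andbT; case: (eqVneq b c) es => [-> //|bc es].
  have E : b = ~~ c by move: bc; case: (b); case: (c).
  by rewrite E in es; rewrite es in ny.
have [exy|xy] := eqVneq x y.
  split.
  - rewrite ren_id_in // => l _; rewrite exy; exact: subst_id.
  - rewrite ren_id_in; last by move=> l _; rewrite exy; exact: subst_id.
    move=> e es; have := fs e; rewrite !mem es !orbT => /(_ isT) /or3P [] // /eqP E.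
      by have Ee := flipK e; rewrite E /flip /= exy in Ee; rewrite Ee es in ny.
    by have Ee := flipK e; rewrite E /flip /= negbK -exy in Ee; rewrite Ee es in nx.
  exists lam, h; split; first exact: walk_contract ws.
  rewrite ren_id_in; last by move=> l _; rewrite exy; exact: subst_id.
  move=> a b ab sub; apply: cs => //; apply: subseq_trans sub _.
  rewrite !labs_cat; apply: cat_subseq => //; exact: (suffix_subseq [:: x; y]).
have yin : (c, y) \in s1 ++ s2.
  have := fs (~~ c, y); rewrite !mem eqxx orbT => /(_ isT).
  rewrite /flip /= negbK => /or3P [/eqP [E]|/eqP [E]|//].
    by rewrite E eqxx in xy.
  by case: (c) E.
split.
- rewrite map_inj_in_uniq // => e f es ft /=; rewrite !ren0 //.
  case: (eqVneq e (c, y)) => [->|ey]; case: (eqVneq f (c, y)) => [->|fy] // E.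
    by rewrite E ft in nx.
  by rewrite -E es in nx.
- move=> _ /mapP [e es ->]; rewrite ren0 //; case: (eqVneq e (c, y)) => [_|ey].
    have := fs (c, x); rewrite !mem eqxx => /(_ isT) /or3P [/eqP [E]|/eqP [E]|H].
    + by case: (c) E.
    + by move: E => E; rewrite E eqxx in xy.
    + apply/mapP; exists (~~ c, x) => //=; rewrite /flip /= /subst.
      by rewrite (negbTE xy).
  have := fs e; rewrite !mem es !orbT => /(_ isT) /or3P [/eqP E|/eqP E|H].
  + rewrite E; apply/mapP; exists (c, y) => //=; by rewrite /subst eqxx.
  + by rewrite -[e]flipK E /flip /= negbK eqxx in ey.
  + apply/mapP; exists (flip e) => //; rewrite ren0 //.
    case: eqP => // E; have Ee : e = (~~ c, y) by rewrite -[e]flipK E.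
    by rewrite Ee in es; rewrite es in ny.
(* The merged blocks have the same level, so [lam] stays valid and every crossing has the distance
   of an old one. *)
exists lam, h; split; first exact: walk_contract ws.
have lE := walk_contract_level ws.
have lS l : lam (subst x y l) = lam l by rewrite /subst; case: eqP => // ->.
move=> a b ab; rewrite labs_ren labs_cat => /(cross_contract ab) [a' [b' [ab' sub H]]].
have := cs a' b' ab'; rewrite labs_cat => /(_ sub).
by case: H => [] [<- <-]; rewrite !lS // -abszN opprB.
Qed.

Lemma subseq_disjoint (L1 L2 : seq nat) x y :
  (forall l, l \in L1 -> l \notin L2) -> subseq [:: x; y; x; y] (L1 ++ L2) ->
  subseq [:: x; y; x; y] L1 \/ subseq [:: x; y; x; y] L2.
Proof.
move=> dis; case/subseq4_split => [|[/mem_subseq s1 /mem_subseq s2]|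
  [/mem_subseq s1 /mem_subseq s2]|[[/mem_subseq s1 /mem_subseq s2]|]]; [by right | | | |by left].
- have /dis/negP [] : x \in L1 by apply: s1; rewrite inE eqxx.
  by apply: s2; rewrite !inE eqxx orbT.
- have /dis/negP [] : x \in L1 by apply: s1; rewrite inE eqxx.
  by apply: s2; rewrite !inE eqxx.
- have /dis/negP [] : y \in L1 by apply: s1; rewrite !inE eqxx orbT.
  by apply: s2; rewrite !inE eqxx.
Qed.

Lemma IW_cat D s t : (forall l, l \in labs s -> l \notin labs t) ->
  IW D s -> IW D t -> IW D (s ++ t).
Proof.
move=> dis [us fs [lam [h [ws cs]]]] [ut ft [mu [k [wt ct]]]]; split.
- rewrite cat_uniq us ut andbT /=; apply/hasPn => e et; apply/negP => es.
  by move: (dis _ (mem_labs es)); rewrite (mem_labs et).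
- by move=> e; rewrite !mem_cat => /orP [/fs->|/ft->]; rewrite ?orbT.
(* The path of [s] returns to its starting height, so shifting its levels lets both paths start at
   height [k]. *)
exists (fun l => if l \in labs s then lam l + (k - h) else mu l)%R, k; split.
  rewrite walk_cat hsum_flip_closed // addr0; apply/andP; split.
    rewrite (eq_walk (lam' := fun l => lam l + (k - h)))%R; last by move=> l ->.
    have {2}-> : k = (h + (k - h))%R by rewrite addrC subrK.
    by rewrite walk_shift.
  rewrite (eq_walk (lam' := mu)) // => l lt; case: ifP => // /dis.
  by rewrite lt.
move=> x y xy; rewrite labs_cat => /(subseq_disjoint dis) [H|H].
  have [xs ys] : x \in labs s /\ y \in labs s.
    by split; apply: (mem_subseq H); rewrite !inE eqxx ?orbT.
  rewrite xs ys; have := cs x y xy H.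
  by rewrite opprD addrACA subrr addr0.
have [xs ys] : x \notin labs s /\ y \notin labs s.
  split; apply/negP => /dis /negP; apply; apply: (mem_subseq H);
    by rewrite !inE eqxx ?orbT.
by rewrite (negbTE xs) (negbTE ys); apply: ct.
Qed.

(** The path is closed, so the moved step keeps its level. A pattern [x y x y] ending in the moved
    letter was [y x y x] before, at the same distance. *)
Lemma IW_rot D e s : IW D (e :: s) -> IW D (rcons s e).
Proof.
case=> us fs [lam [h [ws cs]]]; split.
- by rewrite rcons_uniq.
- by move=> f; rewrite !mem_rcons; apply: fs.
exists lam, (h + stepv e.1)%R; split.
  move: ws => /= /andP [le ws]; rewrite -cats1 walk_cat ws /= andbT.
  have := hsum_flip_closed us fs; rewrite /= hsum_cons => E.
  by rewrite -addrA E addr0.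
move=> x y xy; rewrite -cats1 labs_cat => /subseq4_split [|[_]|[_]|[[H1 H2]|H]].
- by move/size_subseq.
- by move/size_subseq.
- by move/size_subseq.
- have /eqP E : y == e.2 by move: H2 => /=; case: ifP.
  suff H : subseq [:: y; x; y; x] (labs (e :: s)).
    have yx : y != x by rewrite eq_sym.
    by have := cs y x yx H; rewrite -abszN opprB.
  by rewrite /= E eqxx -E.
- by apply: cs => //; apply: subseq_trans H _; exact: subseq_cons.
Qed.

Lemma IW_inv D s : IW D s -> IW D (winv s).
Proof.
case=> us fs [lam [h [ws cs]]]; split.
- by rewrite rev_uniq map_inj_uniq //; exact: inv_inj flipK.
- by move=> e; rewrite !mem_inv => /fs.
exists lam, (h + hsum (cols s))%R; split; first exact: walk_inv.
move=> x y xy; rewrite labs_inv -[[:: x; _; _; _]]revK subseq_rev /rev /= => H.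
have yx : y != x by rewrite eq_sym.
by have := cs y x yx H; rewrite -abszN opprB.
Qed.

Lemma IW_ren D (f : nat -> nat) s : {in labs s &, injective f} ->
  IW D s -> IW D (ren f s).
Proof.
move=> fi [us fs [lam [h [ws cs]]]].
pose g m := nth 0 (labs s) (index m (map f (labs s))).
have gK : {in labs s, cancel f g}.
  move=> l ls; rewrite /g; have fl : f l \in map f (labs s) by exact: map_f.
  have i : index (f l) (map f (labs s)) < size (labs s) by rewrite -(size_map f) index_mem.
  apply: fi => //; first exact: mem_nth.
  by rewrite -(nth_map 0 0) // nth_index.
split.
- rewrite map_inj_in_uniq // => -[c l] [d m] ls ms /= [-> E].
  by congr pair; exact: (fi _ _ (mem_labs ls) (mem_labs ms) E).
- move=> _ /mapP [e es ->]; apply/mapP; exists (flip e) => //; exact: fs.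
exists (lam \o g), h; split.
  by rewrite walk_ren (eq_walk (lam' := lam)) // => l ls /=; rewrite gK.
move=> x y xy; rewrite labs_ren => /subseq_map_inv [t' []].
case: t' => [|p [|q [|r [|t [|? ?]]]]] //= [xp yq xr yt] H.
have ps : p \in labs s by apply: (mem_subseq H); rewrite !inE eqxx.
have qs : q \in labs s by apply: (mem_subseq H); rewrite !inE eqxx orbT.
have rs : r \in labs s by apply: (mem_subseq H); rewrite !inE eqxx !orbT.
have ts : t \in labs s by apply: (mem_subseq H); rewrite !inE eqxx !orbT.
have pr : p = r by apply: fi => //; rewrite -xp.
have qt : q = t by apply: fi => //; rewrite -yq.
subst r t; rewrite /= xp yq !gK //; apply: cs => //.
by apply: contraNneq xy => E; rewrite xp yq E.
Qed.

Lemma IW_base D c x : IW D [:: (c, x); (~~ c, x)].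
Proof.
split.
- by rewrite /= inE xpair_eqE; case: c.
- by move=> e; rewrite !inE => /orP [] /eqP ->; rewrite /flip /= ?negbK eqxx ?orbT.
exists (fun _ => lv 0 c), 0%R; split; first by case: c.
by move=> a b ab /size_subseq.
Qed.

Lemma IW_wclass D : wclass (IW D).
Proof.
split; [exact: IW_ren | exact: IW_rot | exact: IW_cat | exact: IW_contract |
  exact: IW_inv | exact: IW_base].
Qed.

(** * Gluing and contracting words *)

(** Composition of partitions: the second word carries the row [B] to the row [Y]. Gluing connects
    [Y] to the outside only through [B], so a label common to both must occur in [B]. *)
Lemma w_replace W (HW : wclass W) pre B post Y :
  W (pre ++ B ++ post) -> W (winv B ++ Y) ->
  (forall l, l \in labs (pre ++ post) -> l \in labs Y -> l \in labs B) ->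
  W (pre ++ Y ++ post).
Proof.
move=> Ws Wt com.
set K := fresh (pre ++ B ++ post); pose sh l := l + K.
have ltK l : l \in labs (post ++ pre ++ B) -> l < K.
  move=> H; apply: freshP; move: H; rewrite !labs_cat !mem_cat.
  by do !case: (_ \in _).
have Wt' : W (ren sh (winv B ++ Y)) by apply: (w_ren HW) => // l m _ _ /addIn.
have : W ((post ++ pre ++ B) ++ ren sh (winv B ++ Y)).
  apply: (w_cat HW) => //; last by apply: (w_rotn HW); rewrite -catA.
  move=> l /ltK lK; apply/negP; rewrite labs_ren => /mapP [m _ E].
  by move: lK; rewrite E /sh ltnNge leq_addl.
rewrite ren_cat ren_inv catA -!catA [post ++ _]catA => /(w_zip HW) [].
  by rewrite cols_ren.
move=> G [WG GB GE].
(* [g] undoes the shift and gives the intended labels. It has the kernel of [G]: one inclusion is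
   the minimality of [G], the other uses [com]. *)
pose g l := if l < K then l else l - K.
have gsh l : g (sh l) = l by rewrite /g /sh ltnNge leq_addl addnK.
have gid l : l < K -> g l = l by rewrite /g => ->.
have GB' l : l \in labs B -> G l = G (sh l).
  by move: GB; rewrite labs_ren -map_comp => /eq_in_map /(_ l).
have GEg l l' : G l = G l' -> g l = g l'.
  apply: (GE (fun a b => g a = g b)) => //; first by move=> a b d -> ->.
  move=> k kB; rewrite labs_ren (nth_map 0) ?size_map // gsh gid //.
  by apply: ltK; rewrite !labs_cat !mem_cat mem_nth ?size_map ?orbT.
have : W (ren g ((post ++ pre) ++ ren sh Y)).
  apply: (w_ker HW (f := G)); last by rewrite ren_cat.
  move=> l l' ls ls'; split; first exact: GEg.
  have C a : a \in labs ((post ++ pre) ++ ren sh Y) ->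
     (a < K /\ a \in labs (pre ++ post)) \/ exists2 m, a = sh m & m \in labs Y.
    rewrite labs_cat labs_ren mem_cat => /orP [H|/mapP [m mY ->]]; last by right; exists m.
    left; split; last by move: H; rewrite !labs_cat !mem_cat orbC.
    by apply: ltK; rewrite catA labs_cat mem_cat H.
  case: (C _ ls) => [[lK lp]|[m -> mY]]; case: (C _ ls') => [[lK' lp']|[m' -> mY']];
    rewrite ?gsh ?gid // => E; subst => //.
  - by apply: GB'; apply: com.
  - by apply/esym/GB'; apply: com.
rewrite ren_cat ren_comp (ren_id_in (f := g \o sh)); last by move=> l _ /=; rewrite gsh.
rewrite ren_id_in; last first.
  by move=> l ls; apply: gid; apply: ltK; rewrite catA labs_cat mem_cat ls.
by rewrite -catA => /(w_rotn HW); rewrite -catA.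
Qed.

(** Without such a pair all letters have the same colour, and their sum cannot vanish. *)
Lemma adjacent_opposite (s : word) : s != [::] -> hsum (cols s) = 0%R ->
  exists c x y s1 s2, s = s1 ++ (c, x) :: (~~ c, y) :: s2.
Proof.
move=> s0 sum0; apply: NNPP => none.
case: s s0 sum0 none => // -[c x] s _ sum0 none.
suff E : forall x' s1 s2, (c, x) :: s = s1 ++ (c, x') :: s2 ->
    hsum (cols s2) = (stepv c *+ size s2)%R.
  move: sum0; rewrite /= hsum_cons (E x [::] s) // -mulrS.
  by case: (c) => /=; rewrite ?mulNrn; lia.
move=> x' s1 s2; elim: s2 x' s1 => [|[d y] s2 IH] x' s1 E.
  by rewrite hsum_nil mulr0n.
have [dc|dc] := eqVneq d c.
  subst d; rewrite /= hsum_cons (IH y (rcons s1 (c, x'))) ?mulrS //.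
  by rewrite cat_rcons.
case: none; exists c, x', y, s1, s2; rewrite E.
by have -> : ~~ c = d by case: (c) (d) dc => [] [].
Qed.

(** Colours alone allow a stretch of sum zero to be contracted away. Which outer labels [G] merges
    is left open. *)
Lemma w_contract_full W (HW : wclass W) pre X post :
  W (pre ++ X ++ post) -> hsum (cols X) = 0%R ->
  exists G, W (ren G pre ++ ren G post).
Proof.
have [n nX] := ubnP (size X).
elim: n pre X post nX => // n IH pre X post nX Ws sum0.
have [E|X0] := eqVneq X [::].
  by exists id; rewrite !ren_id_in //; move: Ws; rewrite E.
have [c [x [y [X1 [X2 E]]]]] := adjacent_opposite X0 sum0.
move: Ws; rewrite E -!catA /= catA => /(w_contract HW); rewrite !ren_cat -!catA.
set r := subst x y; rewrite [ren r X1 ++ _]catA => /IH [].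
- by move: nX; rewrite E !size_cat !size_ren /= !addnS => /ltnW; rewrite ltnS.
- move: sum0; rewrite E !cols_cat !cols_ren !hsum_cat /= !hsum_cons stepvN.
  by move=> H; rewrite -[RHS]H; lia.
by move=> G; rewrite !ren_comp; exists (G \o r).
Qed.

(** * Members of a class with prescribed crossings *)

(** The distances that occur at crossings of members; the complement becomes the semigroup. Level
    differences do not depend on the choice of [lam]. *)
Definition dist (W : word -> Prop) (n : nat) : Prop :=
  exists s lam h x y, [/\ W s, walk lam h s, x != y,
    subseq [:: x; y; x; y] (labs s) & absz (lam x - lam y)%R = n].

(* Level difference between a step [b] reached after the steps [cs] and an initial step [c]. *)
Definition rlev (c : bool) (cs : seq bool) (b : bool) : int :=
  (lv (stepv c + hsum cs) b - lv 0 c)%R.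

Lemma walk_rotn lam h s t : hsum (cols (s ++ t)) = 0%R ->
  walk lam h (s ++ t) -> walk lam (h + hsum (cols s))%R (t ++ s).
Proof.
rewrite cols_cat hsum_cat => E; rewrite !walk_cat => /andP [ws wt].
by rewrite wt -addrA E addr0.
Qed.

Definition crossed (L : seq nat) x y : bool :=
  subseq [:: x; y; x; y] L || subseq [:: y; x; y; x] L.

Lemma crossedC L x y : crossed L x y = crossed L y x.
Proof. exact: orbC. Qed.

Lemma crossed_rot L1 L2 x y : crossed (L1 ++ L2) x y -> crossed (L2 ++ L1) x y.
Proof.
elim: L1 L2 => [|e L1 IH] L2; first by rewrite cats0.
move=> H; rewrite -cat_rcons; apply: IH; move: H; rewrite -rcons_cat cat_cons.
move: (L1 ++ L2) => L; wlog : x y / subseq [:: x; y; x; y] (e :: L).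
  move=> W /orP [H|H]; first by apply: W => //; rewrite /crossed H.
  by rewrite crossedC; apply: W => //; rewrite /crossed H.
move=> H _; move: H => /=; case: eqP => [->|_] H; rewrite /crossed.
  rewrite -(cats1 L) (@cat_subseq _ [:: y; e; y] [:: e]) ?orbT //.
by rewrite -cats1 (subseq_trans H) // prefix_subseq.
Qed.

Lemma crossed_chord (u v : nat) L1 L2 : u != v ->
  u \notin L1 -> u \notin L2 -> crossed (u :: L1 ++ u :: L2) u v ->
  v \in L1 /\ v \in L2.
Proof.
move=> uv u1 u2; have vu : v != u by rewrite eq_sym.
have no l L : u \notin L -> subseq l L -> u \notin l.
  by move=> uL /mem_subseq sl; apply/negP => /sl; apply/negP.
have H3 (t : seq nat) : subseq t (L1 ++ u :: L2) -> exists t1 t2,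
    [/\ t = t1 ++ t2, subseq t1 L1 & subseq t2 (u :: L2)].
  exact: subseq_split.
case/orP => /=.
  rewrite eqxx => /H3 [[|a [|b [|d t1]]] [t2 [//= E s1 s2]]].
  - move: s2; rewrite -E /= (negbTE vu) => /(no _ _ u2).
    by rewrite !inE eqxx orbT.
  - case: E s1 s2 => <- <- s1 /=; rewrite eqxx => s2.
    by split; rewrite -sub1seq.
  - by case: E s1 => <- <- _ /(no _ _ u1); rewrite !inE eqxx orbT.
  - by case: E s1 => <- <- <- _ /(no _ _ u1); rewrite !inE eqxx orbT.
rewrite (negbTE vu) => /H3 [[|a [|b t1]] [t2 [//= E s1 s2]]].
- move: s2; rewrite -E /= (negbTE vu) => /(no _ _ u2).
  by rewrite !inE eqxx orbT.
- case: E s1 s2 => <- <- s1 /=; rewrite eqxx => /(no _ _ u2).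
  by rewrite !inE eqxx orbT.
- by case: E s1 => <- <- _ /(no _ _ u1); rewrite !inE eqxx orbT.
Qed.

(** Normal form for chord arguments: the ends of [u] have opposite colours, so a rotation puts the
    one of colour [c] first. The splitting of [s] is kept to transport walks and crossings. *)
Lemma chord_rot W (HW : wclass W) (WI : forall s, W s -> IW (fun _ => False) s) s c u :
  W s -> u \in labs s ->
  exists S R, W ((c, u) :: S ++ (~~ c, u) :: R) /\
    exists s1 s2, s = s1 ++ s2 /\ s2 ++ s1 = (c, u) :: S ++ (~~ c, u) :: R.
Proof.
move=> Ws us; have [uns fs _] := WI _ Ws.
have cs : (c, u) \in s.
  case/mapP: us => -[d m] ds /= E; subst m.
  have [->//|dc] := eqVneq c d; have := fs _ ds.
  by rewrite /flip /=; have -> : ~~ d = c by case: (c) (d) dc => [] [].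
move: cs (fs _ cs) Ws; case/splitPr => s1 s2.
rewrite mem_cat inE /flip /= xpair_eqE => /or3P [H|/andP [/eqP E]|H] Ws.
- case/splitPr: H Ws => [t1 t2] Ws; exists (s2 ++ t1), t2; split.
    by rewrite -catA; exact: (w_rotn HW Ws).
  exists (t1 ++ (~~ c, u) :: t2), ((c, u) :: s2); split=> //.
  by rewrite /= -!catA.
- by case: (c) E.
- case/splitPr: H Ws => [t1 t2] Ws; exists t1, (t2 ++ s1); split.
    by have := w_rotn HW Ws; rewrite /= -catA.
  exists s1, ((c, u) :: t1 ++ (~~ c, u) :: t2); split=> //.
  by rewrite /= -!catA.
Qed.

Lemma chord_uniq c u S R : uniq ((c, u) :: S ++ (~~ c, u) :: R) ->
  [/\ u \notin labs S, u \notin labs R & uniq (S ++ R)].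
Proof.
rewrite /= mem_cat inE !negb_or => /andP [/and3P [n1 _ n2]].
rewrite -[(~~ c, u) :: R]/([:: (~~ c, u)] ++ R) uniq_catCA /= mem_cat negb_or.
move=> /andP [/andP [n3 n4] uSR]; split=> //; apply/negP => /mapP [[d m] ds /= E];
  subst m; (have [E|E] : d = c \/ d = ~~ c by case: (d) (c) => [] []; auto);
  subst d; [by rewrite ds in n1 | by rewrite ds in n3 | by rewrite ds in n2 |
  by rewrite ds in n4].
Qed.

(** An occurring distance is available with either sign and any colours: exchanging the two blocks
    changes the sign, rotation fixes the colour opening the chord, and inversion adjusts the
    crossing letter. *)
Lemma cross_word W (HW : wclass W) (WI : forall s, W s -> IW (fun _ => False) s) c b e :
  dist W (absz e) ->
  exists y g S1 S2 R,
    [/\ W ((c, y) :: S1 ++ (b, g) :: S2 ++ (~~ c, y) :: R),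
        flip (b, g) \in R & rlev c (cols S1) b = e].
Proof.
case=> s [lam [h [x [y [Ws ws xy sub dE]]]]].
suff : forall u v, u \in labs s -> crossed (labs s) u v -> u != v ->
    (lam v - lam u)%R = e -> exists y g S1 S2 R,
    [/\ W ((c, y) :: S1 ++ (b, g) :: S2 ++ (~~ c, y) :: R),
        flip (b, g) \in R & rlev c (cols S1) b = e].
  move=> H; have yx : y != x by rewrite eq_sym.
  have [xs ys] : x \in labs s /\ y \in labs s.
    by split; apply: (mem_subseq sub); rewrite !inE eqxx ?orbT.
  have [dE'|dE'] : (lam y - lam x = e \/ lam x - lam y = e)%R by lia.
    by apply: (H x y) => //; rewrite /crossed sub.
  by apply: (H y x) => //; rewrite /crossed sub orbT.
move=> {x y xy sub dE} u v us cr uv ve.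
have [S [R [WSR [s1 [s2 [E1 E2]]]]]] := chord_rot HW WI c Ws us.
have [uS fS _] := WI _ WSR.
have [uns fs _] := WI _ Ws.
have [h' wSR] : exists h', walk lam h' ((c, u) :: S ++ (~~ c, u) :: R).
  rewrite -E2; eexists; apply: walk_rotn; rewrite -E1 //; last exact: ws.
  exact: hsum_flip_closed.
have [nS nR uSR] := chord_uniq uS.
have [vS vR] : v \in labs S /\ v \in labs R.
  apply: (crossed_chord uv nS nR).
  have -> : u :: labs S ++ u :: labs R = labs s2 ++ labs s1.
    by rewrite -labs_cat E2 /labs /= map_cat.
  by apply: crossed_rot; rewrite -labs_cat -E1.
have [d [S1 [S2 ES]]] : exists d S1 S2, S = S1 ++ (d, v) :: S2.
  case/mapP: vS => -[d m] + /= E; rewrite -E => ds.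
  by case/splitPr: ds => S1 S2; exists d, S1, S2.
have fR : flip (d, v) \in R.
  case/mapP: vR => -[d' m] + /= E; rewrite -E => ds.
  have [E'|E'] : d' = d \/ d' = ~~ d by case: (d) (d') => [] []; auto.
    move: uSR; rewrite cat_uniq => /and3P [_ /hasPn /(_ _ ds) /=].
    by rewrite E' ES mem_cat inE eqxx orbT.
  by rewrite /flip /= -E'.
have lev (h0 : int) S1' S2' R' b' : walk lam h0 ((c, u) :: S1' ++ (b', v) :: S2' ++ R') ->
    rlev c (cols S1') b' = e.
  rewrite /= walk_cat /= => /and3P [/eqP Eu _ /andP [/eqP Ev _]].
  by rewrite -ve Eu Ev /rlev /lv; case: (c) (b') => [] []; lia.
have [E|E] : b = d \/ b = ~~ d by case: (d) (b) => [] []; auto.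
  subst b; exists u, v, S1, S2, R; split=> //.
    by move: WSR; rewrite ES -catA.
  by apply: (lev h' _ S2 ((~~ c, u) :: R)); move: wSR; rewrite ES -catA.
(* The letter under the chord has the wrong colour. In the inverse word it is flipped, while the
   chord, now entered at its other end, still opens with [c]. *)
set s' := (c, u) :: S ++ (~~ c, u) :: R in WSR wSR uS fS.
have Ei : winv s' = (winv R ++ (c, u) :: winv S2 ++ (b, v) :: winv S1) ++ [:: (~~ c, u)].
  by rewrite /s' ES !(inv_cat, inv_cons) /flip /= negbK -E -!catA /= -!catA.
have w1 := walk_inv wSR; have W1 := w_inv HW WSR.
have e0 : hsum (cols (winv s')) = 0%R.
  by rewrite hsum_inv (hsum_flip_closed uS fS) oppr0.
move: w1 W1 e0; rewrite Ei -!catA /= -!catA => w1 /(w_rotn HW) W1 /walk_rotn /(_ w1) w2.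
exists u, v, (winv S2), (winv S1), (winv R); split.
- by move: W1; rewrite /= -!catA /= -!catA.
- by rewrite mem_inv flipK E; move: fR; rewrite /flip.
- apply: lev; move: w2; rewrite /= -!catA /= -!catA => w2; exact: w2.
Qed.

Lemma rlev_inj c b cs cs' : rlev c cs b = rlev c cs' b -> hsum cs = hsum cs'.
Proof. by rewrite /rlev /lv; case: (b); lia. Qed.

(** Both ends of a chord have the same level, so the path under it is closed. *)
Lemma chord_sum D c z S R : IW D ((c, z) :: S ++ (~~ c, z) :: R) ->
  hsum (cols S) = 0%R.
Proof.
case=> _ _ [lam [h [/= /andP [/eqP Ez]]]].
by rewrite walk_cat /= Ez /lv => /and3P [_ /eqP + _] _; case: (c) => /=; lia.
Qed.

Lemma cols_nth k (s : word) : nth false (cols s) k = (nth (false, 0) s k).1.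
Proof.
have [ks|ks] := ltnP k (size s); first by rewrite (nth_map (false, 0)).
by rewrite !nth_default // size_map.
Qed.

Lemma nth_ren f k (s : word) : k < size s ->
  nth (false, 0) (ren f s) k =
  ((nth (false, 0) s k).1, f (nth (false, 0) s k).2).
Proof. by move=> ks; rewrite (nth_map (false, 0)). Qed.

Lemma flip_ren f (e : letter) s : flip e \in s -> flip (e.1, f e.2) \in ren f s.
Proof. by move=> /(ren_letter f). Qed.

(** The closing end of the first chord is contracted with the opening end of the second, which
    leaves one chord over both stretches. *)
Lemma chord_cat W (HW : wclass W) c z S R y S' R' :
  W ((c, z) :: S ++ (~~ c, z) :: R) -> W ((c, y) :: S' ++ (~~ c, y) :: R') ->
  exists f g, W ((c, f z) :: (ren f S ++ ren g S') ++ (~~ c, f z) :: ren g R' ++ ren f R).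
Proof.
set F := (c, z) :: _ => WF WP; pose sh l := l + fresh F.
pose r := subst z (sh y); exists r, (r \o sh).
have rz : r z = z by rewrite /r /subst; case: eqP.
have ry : r (sh y) = z by rewrite /r /subst eqxx.
have : W ((R ++ (c, z) :: S ++ [:: (~~ c, z)]) ++ ren sh ((c, y) :: S' ++ (~~ c, y) :: R')).
  apply: (w_cat HW); last by apply: (w_ren HW) => // l m _ _ /addIn.
    move=> l ls; apply/negP; rewrite labs_ren => /mapP [m _ E].
    have : l < fresh F.
      apply: freshP; move: ls; rewrite /F /labs /= !map_cat /= !(mem_cat, inE).
      by rewrite !map_cat /= !(mem_cat, inE); do !case: (_ \in _); do !case: (_ == _).
    by rewrite E /sh ltnNge leq_addl.
  by apply: (w_rotn HW) => /=; rewrite -catA.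
rewrite -[c in (c, y)]negbK /= -catA cat_cons -catA /= -cat_cons catA.
move=> /(w_contract HW); rewrite -/r !ren_cat -!catA => /(w_rotn HW).
by rewrite /= ?ren_cat !ren_comp /= ?rz ?ry -?catA.
Qed.

(* The colours [beta] are read under a chord, one by one: a step at an occurring
   distance is cut out of a member of [W], any other step is created with a new pair. *)
Lemma arch_prefix W (HW : wclass W) (WI : forall s, W s -> IW (fun _ => False) s) c beta :
  exists z Q T R,
    [/\ W ((c, z) :: Q ++ T ++ (~~ c, z) :: R), cols Q = beta &
        forall k, k < size beta ->
          dist W (absz (rlev c (take k beta) (nth false beta k))) ->
          flip (nth (false, 0) Q k) \in R].
Proof.
elim/last_ind: beta => [|beta b [z [Q [T [R [WQ cQ oQ]]]]]].
  exists 0, [::], [::], [::]; split=> //; exact: (w_base HW).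
have sQ : size Q = size beta by rewrite -cQ size_map.
have tk k : k < size beta -> take k (rcons beta b) = take k beta.
  by move=> kb; rewrite -cats1 takel_cat // ltnW.
(* At a distance that does not occur, a new pair is inserted after [Q], and its second end stays in
   the remainder [T]. *)
case: (classic (dist W (absz (rlev c beta b)))) => [db|nb]; last first.
  pose w := fresh ((c, z) :: Q ++ T ++ (~~ c, z) :: R).
  have : W (((c, z) :: Q) ++ (b, w) :: (~~ b, w) :: T ++ (~~ c, z) :: R).
    by apply: (w_insert HW) => //; exact: fresh_notin.
  move=> W1; exists z, (rcons Q (b, w)), ((~~ b, w) :: T), R; split.
  - by rewrite cat_rcons.
  - by rewrite /cols map_rcons -/(cols Q) cQ.
  move=> k; rewrite size_rcons ltnS leq_eqVlt => /orP [/eqP->|kb].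
    by rewrite -cats1 take_size_cat // nth_cat ltnn subnn.
  by rewrite tk // nth_rcons kb => /(oQ _ kb); rewrite nth_rcons sQ kb.
have [y [g [S1 [S2 [R1 [W1 gR eS]]]]]] := cross_word HW WI c b db.
have sumS : hsum (cols S1) = hsum beta := rlev_inj eS.
have sumT : hsum (cols T) = (- hsum beta)%R.
  move: (WI _ WQ); rewrite catA => /chord_sum; rewrite cols_cat hsum_cat cQ; lia.
have {}WQ : W ((c, z) :: (Q ++ T) ++ (~~ c, z) :: R) by rewrite -catA.
have {}W1 : W ((c, y) :: (S1 ++ (b, g) :: S2) ++ (~~ c, y) :: R1) by rewrite -catA.
(* Joining the chords puts [T ++ S1] between [Q] and the crossing letter. Equal levels force its sum
   to be zero, so it can be contracted away. *)
have [f [f' {}W1]] := chord_cat HW WQ W1.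
have {}W1 : W (((c, f z) :: ren f Q) ++ (ren f T ++ ren f' S1) ++
    (b, f' g) :: ren f' S2 ++ (~~ c, f z) :: ren f' R1 ++ ren f R).
  by move: W1; rewrite !(ren_cat, ren_cons) /= -?catA /= -?catA.
have [|G] := w_contract_full HW W1.
  by rewrite cols_cat hsum_cat !cols_ren sumT sumS addNr.
rewrite !(ren_cat, ren_cons, ren_comp) /= -cat_rcons => W3.
eexists _, _, _, _; split; first exact: W3.
  by rewrite /cols map_rcons -/(cols _) cols_ren cQ.
move=> k; rewrite size_rcons ltnS leq_eqVlt => /orP [/eqP->|kb].
  move=> _; rewrite nth_rcons size_ren sQ ltnn eqxx mem_cat; apply/orP; left.
  exact: (flip_ren (G \o f') gR).
rewrite tk // nth_rcons kb => /(oQ _ kb) fk; rewrite nth_rcons size_ren sQ kb.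
rewrite nth_ren ?sQ // mem_cat; apply/orP; right.
exact: (flip_ren (G \o f) fk).
Qed.

(** When the colours sum to zero, so does the remainder [T] of [arch_prefix], and it is contracted
    away. *)
Lemma arch_open W (HW : wclass W) (WI : forall s, W s -> IW (fun _ => False) s) c alpha :
  hsum alpha = 0%R ->
  exists z Q R,
    [/\ W ((c, z) :: Q ++ (~~ c, z) :: R), cols Q = alpha &
        forall k, k < size alpha ->
          dist W (absz (rlev c (take k alpha) (nth false alpha k))) ->
          flip (nth (false, 0) Q k) \in R].
Proof.
move=> s0; have [z [Q [T [R [WQ cQ oQ]]]]] := arch_prefix HW WI c alpha.
have sumT : hsum (cols T) = 0%R.
  by move: (WI _ WQ); rewrite catA => /chord_sum; rewrite cols_cat hsum_cat cQ s0 add0r.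
have sQ : size Q = size alpha by rewrite -cQ size_map.
have [G WG] := @w_contract_full W HW ((c, z) :: Q) T ((~~ c, z) :: R) WQ sumT.
exists (G z), (ren G Q), (ren G R); split=> //; first by rewrite cols_ren.
move=> k ka /(oQ _ ka) fk; rewrite nth_ren ?sQ //; exact: flip_ren.
Qed.

(** A letter under the chord whose partner is not under it crosses the chord. *)
Lemma open_dist D c z A R0 k : IW D ((c, z) :: A ++ (~~ c, z) :: R0) -> k < size A ->
  flip (nth (false, 0) A k) \notin A ->
  ~ D (absz (rlev c (take k (cols A)) (nth false (cols A) k))).
Proof.
case=> us fs [lam [h [ws cs]]] kA nf.
have [nA nR uAR] := chord_uniq us.
set a := nth (false, 0) A k in nf *; have aA : a \in A by exact: mem_nth.
have za : z != a.2 by apply: contraNneq nA => ->; exact: mem_labs.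
have fR : flip a \in R0.
  have := fs a; rewrite !(inE, mem_cat) aA orbT => /(_ isT).
  rewrite (negbTE nf) /= => /or3P [/eqP E|/eqP E|//].
    by move: za; rewrite -[a.2]/((flip a).2) E eqxx.
  by move: za; rewrite -[a.2]/((flip a).2) E eqxx.
have sub : subseq [:: z; a.2; z; a.2] (labs ((c, z) :: A ++ (~~ c, z) :: R0)).
  rewrite /= eqxx -/(labs _) labs_cat.
  apply: (@cat_subseq _ [:: a.2] [:: z; a.2]); rewrite /= ?eqxx ?sub1seq.
    exact: mem_labs.
  exact: (mem_labs fR).
have Ea : lam a.2 = lv (h + stepv c + hsum (cols (take k A)))%R a.1.
  move: ws => /= /andP [_]; rewrite -{1}(cat_take_drop k A) (drop_nth (false, 0)) //.
  by rewrite -catA walk_cat /= => /and3P [_ /eqP].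
have := cs _ _ za sub; rewrite -abszN opprB.
move: ws => /= /andP [/eqP -> _]; rewrite Ea /rlev cols_nth -/a.
rewrite /cols -map_take -/(cols _).
suff -> : (lv (h + stepv c + hsum (cols (take k A))) a.1 - lv h c =
  lv (stepv c + hsum (cols (take k A))) a.1 - lv 0 c)%R by [].
by rewrite /lv; case: (c) (a.1) => [] []; lia.
Qed.

Lemma IW_sub D D' s : (forall n, D' n -> D n) -> IW D s -> IW D' s.
Proof.
move=> DD [us fs [lam [h [ws cs]]]]; split=> //; exists lam, h; split=> // x y xy sub /DD.
exact: cs.
Qed.

Lemma index_labs_or_repeat (A : word) k (l := nth 0 (labs A) k) :
  k < size A -> index l (labs A) = k \/
  exists k', [/\ k' < size A, index l (labs A) = k', k' != k &
    nth 0 (labs A) k' = l].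
Proof.
move=> kA; have lA : l \in labs A by rewrite mem_nth ?size_map.
have [E|ne] := eqVneq (index l (labs A)) k; [by left|right].
exists (index l (labs A)); split=> //; last exact: nth_index.
by rewrite -(size_map snd A) index_mem.
Qed.

(** * Reconstruction of a word from its crossing distances *)

Definition closed (A : word) (l : nat) : bool := ((true, l) \in A) && ((false, l) \in A).

Lemma closed_flip A e : e \in A -> closed A e.2 = (flip e \in A).
Proof. by case: e => [[] l] /= eA; rewrite /closed /flip /= eA ?andbT. Qed.

(** In [A ++ winv (recopy M A)] the blocks inside [A] are doubled, and every other letter is joined
    to its mirror image. *)
Definition recopy (M : nat) (A : word) : word :=
  ren (fun l => if closed A l then l + M else l) A.

(** The word [A ++ X] is glued along [X] to the mirror image of a copy in which the blocks inside
    [A] are renamed. *)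
Lemma IW_double D A X M : IW D (A ++ X) ->
  (forall l, l \in labs (A ++ X) -> l < M) ->
  IW D (A ++ winv (recopy M A)).
Proof.
move=> HI ltM; have [us fs _] := HI.
pose cp l := if closed A l then l + M else l.
have nc l : l \in labs X -> closed A l = false.
  case/mapP => -[b m] eX /= ->; apply/negP => /andP [t f].
  have : (b, m) \in A by case: (b).
  by move=> H; move: us; rewrite cat_uniq => /and3P [_ /hasPn /(_ _ eX)]; rewrite H.
have := w_replace (IW_wclass D) (pre := A) (B := X) (post := [::])
  (Y := winv (recopy M A)).
rewrite !cats0; apply=> //.
- rewrite -inv_cat; apply: (w_inv (IW_wclass D)).
  have -> : recopy M A ++ X = ren cp (A ++ X).
    rewrite ren_cat; congr (_ ++ _); rewrite [RHS]ren_id_in // => l lX.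
    by rewrite /cp nc.
  apply: (w_ren (IW_wclass D)) => // l m /ltM lM /ltM mM; rewrite /cp.
  by case: ifP => _; case: ifP => _; lia.
- move=> l lA; rewrite mem_labs_inv labs_ren => /mapP [m mA E].
  have lM : l < M by apply: ltM; rewrite labs_cat mem_cat lA.
  move: E; case: ifP => [_|nm] E; first by lia.
  subst m; case/mapP: mA nm => e eA ->; rewrite (closed_flip eA) => nf.
  have := fs e; rewrite !mem_cat eA nf => /(_ isT) /= fX.
  exact: (mem_labs fX).
Qed.

(** Yields the chord over [A] across which strings are pulled. A chord over a word [Q] with the
    colours of [A] comes from [arch_open]; gluing the doubled word along [Q] puts [A] in its place.
    The length of the doubled word is the bound in the second hypothesis. *)
Lemma arch W (HW : wclass W) (WI : forall s, W s -> IW (fun _ => False) s) c z A R0 K :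
  IW (fun n => ~ dist W n) ((c, z) :: A ++ (~~ c, z) :: R0) ->
  (forall t, IW (fun n => ~ dist W n) t -> size t <= (size A).*2 -> W t) ->
  (forall l, l \in labs ((c, z) :: A ++ (~~ c, z) :: R0) -> l < K) ->
  exists R, W ((c, z) :: A ++ (~~ c, z) :: R) /\
    forall l, l \in labs R -> l \in labs A \/ K <= l.
Proof.
set p := _ :: _ => HI IH ltK.
set D := (fun n => ~ dist W n) in HI IH.
have [us fs _] := HI.
have Ap l : l \in labs A -> l \in labs p.
  by move=> lA; rewrite /p /= inE labs_cat mem_cat lA orbT.
have HI' : IW D (A ++ ((~~ c, z) :: R0 ++ [:: (c, z)])).
  by have := @w_rotn _ (IW_wclass D) [:: (c, z)] (A ++ (~~ c, z) :: R0) HI;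
    rewrite -catA.
have [nA nR0 uAR0] := chord_uniq us.
have HY : IW D (A ++ winv (recopy K A)).
  apply: (IW_double HI') => l lA; apply: ltK; apply: sub_labs lA => e.
  by rewrite /p !(mem_cat, inE); do !case: (_ \in _); do !case: (_ == _).
have WY : W (A ++ winv (recopy K A)).
  by apply: IH => //; rewrite size_cat size_inv size_ren addnn.
have [z' [Q [R' [WQ cQ oQ]]]] := arch_open HW WI c (chord_sum HI).
have sQ : size Q = size A by rewrite -(size_map fst Q) -/(cols Q) cQ size_map.
have [uQ fQ _] := WI _ WQ; have [nQ nR' uQR'] := chord_uniq uQ.
set P := _ :: _ in WQ uQ fQ.
pose K2 := fresh P; pose sh l := l + K2.
have ltK2 l : l \in labs P -> l < K2 by exact: freshP.
(* [Q] is placed next to the mirror copy in the doubled word, ready to be zipped with it. *)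
have W1 : W ((((~~ c, z') :: R' ++ [:: (c, z')]) ++ Q) ++
    ren sh (winv (recopy K A) ++ A)).
  apply: (w_cat HW).
  - move=> l ls; apply/negP; rewrite labs_ren => /mapP [m _ E].
    have : l < K2.
      apply: ltK2; apply: sub_labs ls => e'.
      by rewrite /P !(mem_cat, inE); do !case: (_ \in _); do !case: (_ == _).
    by rewrite E /sh ltnNge leq_addl.
  - have := w_rotn HW (s := (c, z') :: Q) (t := (~~ c, z') :: R').
    move=> /(_ WQ); rewrite -cat_rcons -cats1 => H.
    by move: H; rewrite /= -!catA.
  - by apply: (w_ren HW) => [l m _ _ /addIn //|]; apply: (w_rotn HW).
move: W1; rewrite ren_cat ren_inv -catA => /(w_zip HW) [].
  by rewrite cQ !cols_ren.
move=> G [WG GB GE].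
(* [F] separates the labels of [A] and [z'] in the glued word; the blocks inside
   [recopy K A] and all they are glued to are lost in the result and sent to [K]. *)
pose F m := if m < K2 then
    if m == z' then K.+1 else
    if m \in labs Q then
      let l := nth 0 (labs A) (index m (labs Q)) in if closed A l then K else l
    else K
  else if m - K2 < K then m - K2 else K.
have Fsh l : F (sh l) = if l < K then l else K.
  by rewrite /F /sh ltnNge leq_addl addnK.
have Fz : F z' = K.+1.
  by rewrite /F eqxx ltK2 // /P /labs /= inE eqxx.
(* A letter leaving [A] crosses [z], hence has an occurring distance, and so the letter of [Q] at
   its place leaves [Q] as well. *)
have opn j : j < size Q -> closed A (nth 0 (labs A) j) \/ flip (nth (false, 0) Q j) \in R'.
  move=> jQ; have jA : j < size A by rewrite -sQ.
  rewrite (nth_map (false, 0)) // closed_flip ?mem_nth //.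
  case: (boolP (flip (nth (false, 0) A j) \in A)) => [|nf]; [by left | right].
  apply: oQ; first by rewrite size_map.
  exact: NNPP (open_dist HI jA nf).
have GF l l' : G l = G l' -> F l = F l'.
  apply: (GE (fun a b => F a = F b)) => //; first by move=> a b d -> ->.
  move=> k kQ; rewrite labs_ren (nth_map 0) ?size_map ?size_ren -?sQ //.
  rewrite Fsh labs_ren (nth_map 0) ?size_map -?sQ //.
  set a := nth 0 (labs A) k; set q := nth 0 (labs Q) k.
  have aA : a \in labs A by rewrite mem_nth // size_map -sQ.
  have aK : a < K by apply/ltK/Ap.
  have qQ : q \in labs Q by rewrite mem_nth // size_map.
  have qz : q != z' by apply: contraNneq nQ => <-.
  have qK2 : q < K2 by apply: ltK2; rewrite /P /labs /= inE map_cat mem_cat qQ orbT.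
  have -> : (if (if closed A a then a + K else a) < K then
      if closed A a then a + K else a else K) = if closed A a then K else a.
    by case: (closed A a); [rewrite ltnNge leq_addl | rewrite aK].
  rewrite /F qK2 (negbTE qz) qQ /=.
  (* [F] looks up the first occurrence of [q]. If [k] is another one, the block [q] lies inside [Q];
     then both positions are closed in [A], and both values are [K]. *)
  have [->//|[k' [k'Q -> kk' E]]] := index_labs_or_repeat kQ.
  suff cl j : j < size Q -> nth 0 (labs Q) j = q -> (exists2 j', j' < size Q & j' != j /\
      nth 0 (labs Q) j' = q) -> closed A (nth 0 (labs A) j).
    rewrite (cl k') //; last by exists k; rewrite // eq_sym.
    by rewrite (cl k) //; exists k'.
  move=> jQ jq [j' j'Q [jj' j'q]]; have [//|fR] := opn j jQ.
  have fQj : flip (nth (false, 0) Q j) = nth (false, 0) Q j'.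
    have : nth (false, 0) Q j != nth (false, 0) Q j'.
      by rewrite nth_uniq 1?eq_sym //; move: uQR'; rewrite cat_uniq => /and3P [].
    move: jq j'q; rewrite !(nth_map (false, 0)) // => <-.
    case: (nth _ Q j) (nth _ Q j') => [b1 l1] [b2 l2] /= ->.
    by rewrite /flip /= xpair_eqE eqxx andbT; case: (b1) (b2) => [] [].
  move: uQR'; rewrite cat_uniq => /and3P [_ /hasPn /(_ _ fR)].
  by rewrite fQj mem_nth.
have GshI l l' : l \in labs A -> l' \in labs A -> G (sh l) = G (sh l') -> l = l'.
  by move=> /Ap /ltK lK /Ap /ltK lK' /GF; rewrite !Fsh lK lK'.
have GzI l : l \in labs A -> G (sh l) <> G z'.
  by move=> /Ap /ltK lK /GF; rewrite Fz Fsh lK; lia.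
pose im := [seq G (sh l) | l <- labs A].
(* [g] gives [A] and the chord their names back and moves all other labels to [K] or beyond. *)
pose g m := if m == G z' then z else
  if m \in im then nth 0 (labs A) (index m im) else m + K.
have gA l : l \in labs A -> g (G (sh l)) = l.
  move=> lA; rewrite /g; case: eqP => [/(GzI _ lA) //|_].
  have i : G (sh l) \in im by apply/mapP; exists l.
  rewrite i; have i' : index (G (sh l)) im < size (labs A) by rewrite -(size_map (G \o sh)) index_mem.
  apply: GshI => //; first exact: mem_nth.
  by move: (nth_map 0 0 (G \o sh) i') => /= <-; exact: nth_index.
have gz : g (G z') = z by rewrite /g eqxx.
have zK : z < K by apply: ltK; rewrite /p labs_cons inE eqxx.
have gim m : m \in im -> m != G z' -> g m \in labs A.
  case/mapP => l lA -> _; rewrite gA //.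
have gI : injective g.
  move=> m m'; case: (boolP (m \in im)) => [/mapP [l lA ->]|mi];
    case: (boolP (m' \in im)) => [/mapP [l' lA' ->]|mi'].
  - by rewrite !gA // => ->.
  - rewrite gA // /g (negbTE mi'); case: eqP => [_ E|_ E].
      by rewrite E (negbTE nA) in lA.
    by move: (ltK _ (Ap _ lA)); rewrite E ltnNge leq_addl.
  - rewrite gA // /g (negbTE mi); case: eqP => [_ E|_ E].
      by rewrite -E (negbTE nA) in lA'.
    by move: (ltK _ (Ap _ lA')); rewrite -E ltnNge leq_addl.
  - rewrite /g (negbTE mi) (negbTE mi').
    case: eqP => [->|_]; case: eqP => [->|_] // E; last exact: addIn E.
      by move: zK; rewrite E ltnNge leq_addl.
    by move: zK; rewrite -E ltnNge leq_addl.
have W2 : W ((c, z) :: A ++ (~~ c, z) :: ren (g \o G) R').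
  have : W (ren g ((ren G [:: (c, z')] ++ ren G (ren sh A)) ++ ren G ((~~ c, z') :: R'))).
    apply: (w_ren HW) => [m m' _ _ /gI //|]; rewrite -catA.
    move: WG; rewrite -cat_cons ren_cat -!catA => /(w_rotn HW).
    by rewrite -!catA.
  rewrite !(ren_cat, ren_cons, ren_comp) /= gz.
  by rewrite ren_id_in // => l lA; exact: gA.
exists (ren (g \o G) R'); split=> // l lR; have [u2 _ _] := WI _ W2.
have [_ nzR _] := chord_uniq u2.
move: lR (lR) nzR; rewrite {1}labs_ren => /mapP [m _ -> /=] glR nzR.
case: (boolP (G m \in im)) => mi.
  left; apply: gim => //; apply: contraNneq nzR => E; by rewrite -gz -E.
right; move: glR; rewrite /g (negbTE mi); case: eqP => [_|_ _]; last exact: leq_addl.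
by rewrite (negbTE nzR).
Qed.

Lemma w_contract_r W (HW : wclass W) c x y s1 s2 :
  W (s1 ++ (c, x) :: (~~ c, y) :: s2) -> W (ren (subst y x) (s1 ++ s2)).
Proof.
move=> /(w_contract HW); apply: (w_ker HW) => l l' _ _; rewrite /subst.
by case: (eqVneq l y) (eqVneq l x) (eqVneq l' y) (eqVneq l' x) =>
  [->|?] [?|?] [->|?] [?|?]; split=> *; subst => //;
  match goal with H : is_true (?a != ?a) |- _ => by rewrite eqxx in H end.
Qed.

Lemma ren_subst_id x y s : y \notin labs s -> ren (subst x y) s = s.
Proof.
move=> ys; apply: ren_id_in => l ls; rewrite /subst; case: eqP => // E.
by rewrite -E ls in ys.
Qed.

Lemma subst_inj x y s : x \notin labs s -> {in labs s &, injective (subst x y)}.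
Proof.
move=> xs l l' ls ls'; rewrite /subst.
case: eqP => [->|_]; case: eqP => [->|_] // E.
  by rewrite E ls' in xs.
by rewrite -E ls in xs.
Qed.

(* The end of the string [x] is pulled through the word [A], across the chord [z]. *)
Lemma w_slide W (HW : wclass W) (WI : forall s, W s -> IW (fun _ => False) s) c z A R pre x post :
  W ((c, z) :: A ++ (~~ c, z) :: R) -> W (pre ++ A ++ (~~ c, x) :: post) ->
  z \notin labs (pre ++ A ++ (~~ c, x) :: post) ->
  (forall l, l \in labs R -> l \in labs (pre ++ A ++ (~~ c, x) :: post) -> l \in labs A) ->
  W (pre ++ (~~ c, x) :: (c, z) :: A ++ (~~ c, z) :: post).
Proof.
set s := pre ++ _ => WP Ws zs com.
have [uP fP _] := WI _ WP; have [us fs _] := WI _ Ws.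
have [nzA nzR _] := chord_uniq uP.
have sub l : l \in labs (pre ++ (~~ c, x) :: post) -> l \in labs s.
  by apply: sub_labs => e; rewrite /s !(mem_cat, inE); do !case: (_ \in _); do !case: (_ == _).
have nz t : {subset t <= s} -> z \notin labs t.
  by move=> ts; apply: contraNN zs; apply: sub_labs.
have W1 : W (winv A ++ ((~~ c, z) :: winv R ++ [:: (c, z)])).
  have := w_inv HW WP; rewrite !(inv_cons, inv_cat) /flip /= negbK -!catA => W1.
  have := w_rotn HW (s := winv R ++ [:: (c, z)]) (t := winv A ++ [:: (~~ c, z)]).
  by rewrite -!catA => H; exact: (H W1).
(* First gluing: [A] is replaced by the other side of the chord word, which brings an end of [z]
   next to [x]. *)
have : W (pre ++ ((~~ c, z) :: winv R ++ [:: (c, z)]) ++ (~~ c, x) :: post).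
  apply: (w_replace HW Ws W1) => l lp.
  have lz : l != z by apply: contraNneq zs => <-; exact: sub.
  case/mapP => e; rewrite !(inE, mem_cat) => /or3P [/eqP->|eR|/eqP->] El;
    try by rewrite El eqxx in lz.
  by apply: com (sub _ lp); rewrite -mem_labs_inv El; exact: mem_labs.
have -> : pre ++ ((~~ c, z) :: winv R ++ [:: (c, z)]) ++ (~~ c, x) :: post =
    (pre ++ (~~ c, z) :: winv R) ++ (c, z) :: (~~ c, x) :: post.
  by rewrite -!catA /= -catA.
(* This contraction joins [z] to [x], so that the end of [x] now stands before [winv R]. *)
move=> /(w_contract_r HW).
rewrite !(ren_cat, ren_cons) !ren_subst_id ?mem_labs_inv //; first last.
- by apply: nz => e ep; rewrite /s mem_cat ep.
- by apply: nz => e ep; rewrite /s !(mem_cat, inE) ep !orbT.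
rewrite /subst eqxx /= => W2.
(* Second gluing: [winv R] is turned back into [A], this time with its chord. *)
have W3 : W (winv (winv R) ++ ((c, z) :: A ++ [:: (~~ c, z)])).
  by rewrite invK; apply: (w_rotn HW); rewrite /= -catA.
have := w_replace HW (pre := pre ++ [:: (~~ c, x)]) (B := winv R) (post := post)
  (Y := (c, z) :: A ++ [:: (~~ c, z)]).
rewrite -!catA /= -!catA; apply=> //; first by move: W2; rewrite -catA.
move=> l lp; have lz : l != z.
  apply: contraNneq zs => <-; apply: sub; move: lp.
  by apply: sub_labs => e; rewrite !(mem_cat, inE).
rewrite -[z :: _]/(labs ((c, z) :: A ++ [:: (~~ c, z)])).
case/mapP => e; rewrite !(inE, mem_cat) => /or3P [/eqP->|eA|/eqP->] El;
  try by rewrite El eqxx in lz.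
(* The partner of a letter of [A] lies in [A] or in [R]. In the first case both letters of the block
   are in [A], so the block cannot occur outside. *)
rewrite mem_labs_inv; have := fP e; rewrite !(inE, mem_cat) eA orbT => /(_ isT).
have fl : (flip e).2 = l by [].
case/or4P => [/eqP E|fA|/eqP E|fR].
- by rewrite -fl E eqxx in lz.
- have [f fp fl'] : exists2 f, f \in pre ++ (~~ c, x) :: post & l = f.2.
    by case/mapP: lp => f fp ->; exists f.
  have fA' : f \in A.
    have [->//|->//] : f = e \/ f = flip e.
    by move: El fl'; case: (e) (f) => [[] m] [[] m'] /= <- <-; [left|right|right|left].
  move: us; rewrite /s catA cat_uniq cat_uniq => /and3P [/and3P [_ n1 _] n2 _].
  move: fp; rewrite mem_cat => /orP [fp|fp].
    by case/hasP: n1; exists f.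
  by case/hasP: n2; exists f; rewrite // mem_cat fA' orbT.
- by rewrite -fl E eqxx in lz.
- by rewrite -fl; exact: mem_labs.
Qed.

(** The mirror image of [w_slide], obtained by inverting all words. *)
Lemma w_slide_inv W (HW : wclass W) (WI : forall s, W s -> IW (fun _ => False) s) c z A R pre x post :
  W ((c, z) :: A ++ (~~ c, z) :: R) -> W (pre ++ (c, x) :: A ++ post) ->
  z \notin labs (pre ++ (c, x) :: A ++ post) ->
  (forall l, l \in labs R -> l \in labs (pre ++ (c, x) :: A ++ post) -> l \in labs A) ->
  W (pre ++ (c, z) :: A ++ (~~ c, z) :: (c, x) :: post).
Proof.
move=> WP Ws zs com.
have WP' : W ((c, z) :: winv A ++ (~~ c, z) :: winv R).
  have := w_inv HW WP; rewrite !(inv_cons, inv_cat) /flip /= negbK -!catA => /(w_rotn HW) /=.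
  by rewrite -!catA.
have E : winv (pre ++ (c, x) :: A ++ post) = winv post ++ winv A ++ (~~ c, x) :: winv pre.
  by rewrite !(inv_cat, inv_cons) -!catA.
have := w_slide HW WI (pre := winv post) (x := x) (post := winv pre) WP'.
rewrite -E mem_labs_inv => /(_ (w_inv HW Ws) zs) H.
have {H}/(w_inv HW) : W (winv post ++ (~~ c, x) :: (c, z) :: winv A ++ (~~ c, z) :: winv pre).
  by apply: H => l; rewrite !mem_labs_inv; exact: com.
by rewrite !(inv_cat, inv_cons) !invK /flip /= !negbK -!catA.
Qed.

Theorem IW_generated W (HW : wclass W) (WI : forall s, W s -> IW (fun _ => False) s) s :
  IW (fun n => ~ dist W n) s -> W s.
Proof.
have [n ns] := ubnP (size s); elim: n s ns => // n IH s ns Is.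
set D := (fun n => ~ dist W n) in Is IH *; have HD := IW_wclass D.
have [->|s0] := eqVneq s [::]; first exact: w_nil.
have [us fs _] := Is.
have [c [x [y [s1 [s2 Es]]]]] := adjacent_opposite s0 (hsum_flip_closed us fs).
(* If the two letters form a block, it is removed and inserted again. *)
have [xy|xy] := eqVneq x y.
  subst y s; have := Is => /(w_contract1 HD) Is'.
  apply: (w_insert HW); last first.
    by apply: IH => //; move: ns; rewrite !size_cat /= !addnS; lia.
  have := w_rotn HD Is; rewrite /= => Is2.
  have [us2 _ _] := Is2; have [_ + _] := chord_uniq (S := [::]) us2.
  by apply: contraNN; apply: sub_labs => e; rewrite !mem_cat orbC.
have := Is; rewrite Es => /(w_rotn HD) /= Is1.
set T := s2 ++ s1 in Is1.
suff : W ((c, x) :: (~~ c, y) :: T).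
  by move=> WT; apply: (w_rotn HW (s := (c, x) :: (~~ c, y) :: s2)); rewrite /= -?catA.
have sT : size s = (size T).+2 by rewrite Es /T !size_cat /= !addnS addnC.
have [u1 f1 _] := Is1.
have yT : (c, y) \in T.
  have := f1 (~~ c, y); rewrite !inE eqxx orbT /flip /= negbK => /(_ isT).
  case/or3P => [/eqP [E]|/eqP [E]|//]; first by rewrite E eqxx in xy.
  by case: (c) E.
have xT : (~~ c, x) \in T.
  have := f1 (c, x); rewrite !inE eqxx /flip /= => /(_ isT).
  case/or3P => [/eqP [E]|/eqP [E]|//]; first by case: (c) E.
  by rewrite E eqxx in xy.
have [A [R ET]] : exists A R, T = A ++ (c, y) :: R.
  by case/splitPr: yT => A R; exists A, R.
rewrite ET in Is1 sT xT u1 f1 *.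
have Iy : IW D ((~~ c, y) :: A ++ (c, y) :: R ++ [:: (c, x)]).
  by have := w_rot HD Is1; rewrite -cats1 /= -catA.
have [uy _ _] := Iy; have [nyA nyR' _] : [/\ y \notin labs A,
    y \notin labs (R ++ [:: (c, x)]) & True].
  by have := chord_uniq (c := ~~ c); rewrite negbK => /(_ _ _ _ uy) [].
have nyR : y \notin labs R.
  by apply: contraNN nyR'; apply: sub_labs => e; rewrite mem_cat => ->.
have sz : size s = (size A + size R).+3 by rewrite sT size_cat /= addnS.
set K := fresh ((c, x) :: (~~ c, y) :: A ++ (c, y) :: R).
have ltK t l : {subset t <= (c, x) :: (~~ c, y) :: A ++ (c, y) :: R} ->
    l \in labs t -> l < K.
  by move=> ts /(sub_labs ts) /freshP.
have IHt m t : m.*2 < size s -> IW D t -> size t <= m.*2 -> W t.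
  by move=> ms It tm; apply: IH => //; lia.
(* In the contracted word the other end of [y] bears the name [x]; pulling this end back across the
   chord [y] recovers the word. *)
have Icon : IW D (A ++ (c, x) :: R).
  have := w_contract HD (s1 := [::]) Is1; rewrite /= !(ren_cat, ren_cons) !ren_subst_id //.
  by rewrite /subst eqxx.
(* If [A] has less than half the length of [s], the doubled word in [arch] is shorter than [s], and
   [x] is pulled through [A]. *)
have [big|small] := ltnP (size A).*2 (size s).
  have Iy' : IW D ((~~ c, y) :: A ++ (~~ ~~ c, y) :: R ++ [:: (c, x)]) by rewrite negbK.
  have [|R' [WP comR]] := arch HW WI Iy' (fun t => IHt (size A) t big) (K := K).
    move=> l; apply: ltK => e; rewrite negbK !(inE, mem_cat).
    by do !case: (_ \in _); do !case: (_ == _).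
  have := w_slide HW WI (pre := [::]) (x := x) (post := R) WP.
  rewrite /= !negbK; apply.
  - by apply: IH => //; move: ns; rewrite sz !size_cat /=; lia.
  - by rewrite labs_cat labs_cons mem_cat inE (negbTE nyA) (negbTE nyR) orbF eq_sym.
  move=> l /comR [//|Kl] lt; have : l < K.
    apply: ltK lt => e; rewrite !(inE, mem_cat).
    by do !case: (_ \in _); do !case: (_ == _).
  by rewrite ltnNge Kl.
(* Otherwise [R] is the short side, and stretches with at most one letter more than [R] may be
   doubled. *)
have szAR : (size R).+3 <= size A by move: small; rewrite sz -addnn -!addnS leq_add2l.
have dbl m : (size R).+3 <= size A -> m <= (size R).+1 -> m.*2 < size s.
  by rewrite sz; move: (size A) (size R) => a r; clear; lia.
have szlt t : size t < size s -> IW D t -> W t.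
  by move=> ts; apply: IH; apply: leq_trans ts _.
(* If the other end of [x] lies in [R], the stretch [R2] from there to [(c, x)] is short, and the
   roles are exchanged: [y] is pulled through [R2], across the chord [x]. *)
move: xT; rewrite mem_cat inE xpair_eqE (negbTE xy) andbF /= => /orP [xA|xR]; last first.
  have [R1 [R2 ER]] : exists R1 R2, R = R1 ++ (~~ c, x) :: R2.
    by case/splitPr: xR => R1 R2; exists R1, R2.
  pose V := A ++ (c, y) :: R1.
  have I2 : IW D ((~~ c, x) :: R2 ++ (c, x) :: (~~ c, y) :: V).
    have Is2 : IW D (((c, x) :: (~~ c, y) :: V) ++ (~~ c, x) :: R2).
      by move: Is1; rewrite ER /V /= -catA.
    exact: (w_rotn HD Is2).
  have I2' : IW D ((~~ c, x) :: R2 ++ (~~ ~~ c, x) :: (~~ c, y) :: V) by rewrite negbK.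
  have [ux _ _] := I2'; have [nxR2 nxV _] := chord_uniq ux.
  have sub2 : {subset (~~ c, x) :: R2 ++ (~~ ~~ c, x) :: (~~ c, y) :: V <=
      (c, x) :: (~~ c, y) :: A ++ (c, y) :: R}.
    move=> e; rewrite negbK ER /V !(inE, mem_cat).
    by do !case: (_ \in _); do !case: (_ == _).
  have szR2 : (size R2).*2 < size s.
    by apply: dbl szAR _; rewrite ER size_cat /=; move: (size R1) (size R2) => r r'; clear; lia.
  have [|R' [WP comR]] := arch HW WI I2' (fun t => IHt (size R2) t szR2) (K := K).
    by move=> l; apply: ltK.
  have := w_slide_inv HW WI (pre := [::]) (x := y) (post := V) WP.
  rewrite /= !negbK => H.
  have {}H : W ((~~ c, x) :: R2 ++ (c, x) :: (~~ c, y) :: V).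
    apply: H.
    - have : IW D (ren (subst y x) (((~~ c, x) :: R2) ++ V)).
        exact: (w_contract_r HD (s1 := (~~ c, x) :: R2) (s2 := V) I2).
      rewrite ren_cat ren_cons !ren_subst_id //; last first.
        by apply: contraNN nxV; apply: sub_labs => e; rewrite inE => ->; rewrite orbT.
      rewrite /subst eqxx; apply: szlt.
      rewrite sz ER /V /= ?size_cat /= ?size_cat /=.
      by move: (size A) (size R1) (size R2) => a r r'; clear; lia.
    - rewrite inE negb_or xy /=; apply/negP => /mapP [e].
      rewrite mem_cat => /orP [eR|eV] E.
        by rewrite E (mem_labs eR) in nxR2.
      by move: nxV; rewrite labs_cons inE E (mem_labs eV) orbT.
    - move=> l /comR [//|Kl] lt; have : l < K.
        apply: (ltK ((~~ c, y) :: R2 ++ V) l _ lt) => e He; apply: sub2; move: He; rewrite !(inE, mem_cat).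
        by do !case: (_ \in _); do !case: (_ == _).
      by rewrite ltnNge Kl.
  have := w_rotn HW (s := (~~ c, x) :: R2) H.
  by rewrite /V ER /= -catA.
(* If it lies in [A], the short side of [y] is [R ++ [:: (c, x)]], which contains the end to be
   moved. A temporary label [K] takes its place: [(c, x)] is pulled through [R ++ [:: (c, K)]] and
   then contracted with [(~~ c, K)], which turns [K] back into [x]. *)
have [A1 [A2 EA]] : exists A1 A2, A = A1 ++ (~~ c, x) :: A2.
  by case/splitPr: xA => A1 A2; exists A1, A2.
have I3 : IW D ((c, y) :: (R ++ [:: (c, x)]) ++ (~~ c, y) :: A).
  have := w_rotn HD (s := (c, x) :: (~~ c, y) :: A) (t := (c, y) :: R) Is1.
  by rewrite -catA.
have sub3 : {subset (c, y) :: (R ++ [:: (c, x)]) ++ (~~ c, y) :: A <=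
    (c, x) :: (~~ c, y) :: A ++ (c, y) :: R}.
  by move=> e; rewrite !(inE, mem_cat); do !case: (_ \in _); do !case: (_ == _).
have nxR : x \notin labs R.
  have ux : uniq ((c, x) :: ((~~ c, y) :: A1) ++ (~~ c, x) :: A2 ++ (c, y) :: R).
    by move: u1; rewrite EA /= -catA.
  have [_ + _] := chord_uniq ux; apply: contraNN; apply: sub_labs => e.
  by rewrite mem_cat inE => ->; rewrite !orbT.
have szR : (size (R ++ [:: (c, x)])).*2 < size s.
  by apply: dbl szAR _; rewrite size_cat addn1.
(* New labels start at [K.+1], so that [K] stays free. *)
have [|R' [WP comR]] := arch HW WI I3 (fun t => IHt _ t szR) (K := K.+1).
  by move=> l lt; rewrite ltnS ltnW //; apply: ltK lt.
have KR l : l \in labs R -> l < K.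
  by apply: ltK => e eR; rewrite !(inE, mem_cat) eR !orbT.
have KA l : l \in labs A -> l < K.
  by apply: ltK => e eA; rewrite !(inE, mem_cat) eA !orbT.
have Kx : x < K by apply: (ltK [:: (c, x)]); rewrite ?labs_cons ?inE // => e; rewrite !inE => ->.
have Ky : y < K.
  by apply: (ltK [:: (~~ c, y)]); rewrite ?labs_cons ?inE // => e; rewrite !inE => ->; rewrite orbT.
have KRx l : l \in labs (R ++ [:: (c, x)]) -> l < K.
  by rewrite labs_cat mem_cat => /orP [/KR //|]; rewrite inE => /eqP ->.
pose R'' := ren (subst K x) R'.
have W1 : W ((c, y) :: (R ++ [:: (c, K)]) ++ (~~ c, y) :: R'').
  have : W (ren (subst K x) ((c, y) :: (R ++ [:: (c, x)]) ++ (~~ c, y) :: R')).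
    apply: (w_ren HW) WP; apply: subst_inj; apply/negP => /mapP [e].
    rewrite inE mem_cat inE => /or4P [/eqP -> /= E|eR E|/eqP -> /= E|eR' E].
    - by rewrite -E ltnn in Ky.
    - by have := KRx _ (mem_labs eR); rewrite -E ltnn.
    - by rewrite -E ltnn in Ky.
    - by case: (comR _ (mem_labs eR')); rewrite -E ?ltnn // => /KRx; rewrite ltnn.
  rewrite !(ren_cat, ren_cons) ren_subst_id //= /subst eqxx.
  by rewrite eq_sym (negbTE xy).
have W2 : W ((c, x) :: R ++ (c, K) :: (~~ c, K) :: A).
  apply: (@w_insert W HW c K ((c, x) :: R) A).
    apply/negP => /mapP [e]; rewrite !(inE, mem_cat) => /or3P [/eqP-> /= E|eR E|eA E].
    - by rewrite -E ltnn in Kx.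
    - by have := KR _ (mem_labs eR); rewrite -E ltnn.
    - by have := KA _ (mem_labs eA); rewrite -E ltnn.
  apply: szlt; last exact: (w_rotn HD Icon).
  by rewrite sz /= size_cat; move: (size A) (size R) => a r; clear; lia.
have H : W (((c, y) :: (R ++ [:: (c, K)]) ++ [:: (~~ c, y)]) ++ (c, x) :: (~~ c, K) :: A).
  rewrite cat_cons -[(_ ++ [:: (~~ c, y)]) ++ _]catA.
  apply: (w_slide_inv HW WI (pre := [::]) (x := x) (post := (~~ c, K) :: A) W1).
  - by rewrite /= -catA.
  - apply/negP => /mapP [e].
    rewrite !(inE, mem_cat) -!orbA => /orP [/eqP-> /= E|/or4P [eR E|/eqP-> /= E|/eqP-> /= E|eA E]].
    + by rewrite E eqxx in xy.
    + by rewrite E (mem_labs eR) in nyR.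
    + by rewrite E ltnn in Ky.
    + by rewrite E ltnn in Ky.
    + by rewrite E (mem_labs eA) in nyA.
  move=> l; rewrite labs_ren => /mapP [m mR' ->]; rewrite /subst.
  case: (eqVneq m x) => [_ _|mx]; first by rewrite labs_cat mem_cat inE eqxx orbT.
  case: (comR _ mR') => [|Km lt].
    rewrite labs_cat mem_cat => /orP [mR _|]; first by rewrite labs_cat mem_cat mR.
    by rewrite inE (negbTE mx).
  have : m <= K.
    case/mapP: lt => e.
    rewrite !(inE, mem_cat) -!orbA => /orP [/eqP->|/or4P [eR|/eqP->|/eqP->|eA]] ->.
    + exact: ltnW.
    + exact/ltnW/KR/mem_labs.
    + by [].
    + by [].
    + exact/ltnW/KA/mem_labs.
  by rewrite leqNgt Km.
move: H => /(w_contract HW); rewrite !(ren_cat, ren_cons).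
have nKA : K \notin labs A by apply/negP => /KA; rewrite ltnn.
have nKR : K \notin labs R by apply/negP => /KR; rewrite ltnn.
rewrite !ren_subst_id //= /subst eqxx ltn_eqF // => H.
have := w_rotn HW (s := (c, y) :: R) (t := (c, x) :: (~~ c, y) :: A).
by rewrite /=; apply; move: H; rewrite -!catA.
Qed.

(** * Occurring distances and addition *)

(** A discrete intermediate value theorem: an up-step at level [t] makes the predicate [t < h] true,
    a down-step makes it false, and no other step changes it. *)
Lemma walk_level_count lam h s (t : int) : walk lam h s ->
  (hsum (cols [seq e <- s | lam e.2 == t]) =
  (nat_of_bool (t < h + hsum (cols s))%R)%:Z - (nat_of_bool (t < h)%R)%:Z)%R.
Proof.
elim: s h => [|e s IH] h /=; first by rewrite hsum_nil addr0 subrr.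
case/andP => /eqP le /IH E; rewrite hsum_cons addrA.
have -> : hsum (cols (if lam e.2 == t then e :: [seq e <- s | lam e.2 == t]
    else [seq e <- s | lam e.2 == t])) =
    ((if lam e.2 == t then stepv e.1 else 0) +
    hsum (cols [seq e <- s | lam e.2 == t]))%R.
  by case: ifP => _; rewrite /= ?hsum_cons ?add0r.
rewrite E le [LHS]addrC -[LHS]addrA; congr (_ + _)%R; rewrite /lv; case: (e.1) => /=; clear.
  by case: eqP; case: ltrP; case: ltrP; lia.
by case: eqP; case: ltrP; case: ltrP; lia.
Qed.

(** The contrapositive says that the distances that do not occur are closed under addition. *)
Lemma dist_split W (HW : wclass W) (WI : forall s, W s -> IW (fun _ => False) s) a b :
  dist W (a + b) -> dist W a \/ dist W b.
Proof.
have [->|a0] := posnP a; first by rewrite add0n; right.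
have [->|b0] := posnP b; first by rewrite addn0; left.
move=> dab; have [y [g [S1 [S2 [R [Ww gR Er]]]]]] :=
  @cross_word W HW WI false false (a + b)%:Z dab.
set w := _ :: _ in Ww; have [uw fw [lam [h [ww _]]]] := WI _ Ww.
have ww' := ww; move: ww'; rewrite /w /= walk_cat /= => /and4P [/eqP Ey ws1 /eqP Eg _].
have Eg' : lam g = (h + (a + b)%:Z)%R.
  by move: Er Eg; rewrite /rlev /lv /=; lia.
have Hs : (h + 1 + hsum (cols S1) = h + (a + b)%:Z)%R by rewrite -Eg' Eg.
pose t := (h + a%:Z)%R.
have cnt := walk_level_count t ws1; rewrite Hs in cnt.
(* If all blocks at level [t] stayed inside [S1], their signed count would vanish; but the path
   passes this level once upwards in total between [y] and [g]. *)
have [x [b' [xS1 xt nf]]] : exists x b', [/\ (b', x) \in S1, lam x = t & flip (b', x) \notin S1].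
  apply: NNPP => no.
  have : hsum (cols [seq e <- S1 | lam e.2 == t]) = 0%R.
    apply: hsum_flip_closed.
      by apply: filter_uniq; move: uw; rewrite /w /= cat_uniq => /and3P [].
    move=> e; rewrite !mem_filter => /andP [/eqP et eS]; rewrite /flip /= et eqxx /=.
    case: (boolP (flip e \in S1)) => // nf; case: no; exists e.2, e.1.
    by split=> //; rewrite -surjective_pairing.
  rewrite cnt /t; case: ltrP; case: ltrP; move: a0 b0; clear; lia.
have uw' : uniq ((false, y) :: (S1 ++ (false, g) :: S2) ++ (~~ false, y) :: R).
  by rewrite -catA.
have [ny nyR _] := chord_uniq uw'.
have xy : x != y.
  apply: contraNneq ny => <-; apply: (@mem_labs (b', x)); by rewrite mem_cat xS1.
have xg : x != g by apply/eqP => E; move: xt; rewrite E Eg' /t; lia.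
have := fw (b', x); rewrite /w !(inE, mem_cat) xS1 orbT (negbTE nf) => /(_ isT).
(* The partner of [x] lies in [S2], and [x] crosses [g] at distance [b], or in [R], and [x] crosses
   [y] at distance [a]. *)
rewrite /flip /= !xpair_eqE (negbTE xy) (negbTE xg) !andbF /= => /orP [x2|xR].
  right; exists w, lam, h, x, g; split=> //; last by rewrite xt Eg' /t; lia.
  rewrite /w labs_cons labs_cat; apply: (subseq_trans _ (subseq_cons _ _)).
  apply: (@cat_subseq _ [:: x] [:: g; x; g]); first by rewrite sub1seq; exact: (mem_labs xS1).
  rewrite /= eqxx -/(labs _) labs_cat; apply: (@cat_subseq _ [:: x] [:: g]).
    by rewrite sub1seq; exact: (mem_labs x2).
  by rewrite sub1seq inE; apply/orP; right; exact: (mem_labs gR).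
left; exists w, lam, h, y, x; split=> //; first by rewrite eq_sym.
  rewrite /w /= eqxx -/(labs _) labs_cat.
  apply: (@cat_subseq _ [:: x] [:: y; x]); first by rewrite sub1seq; exact: (mem_labs xS1).
  rewrite -cat1s labs_cons labs_cat -cat_cons.
  apply: (@cat_subseq _ [::] [:: y; x]); first exact: sub0seq.
  by rewrite /= eqxx sub1seq; exact: (mem_labs xR).
by rewrite xt Ey /t /lv; lia.
Qed.

(** * Partitions as labelled rows *)

(** The first position of a label is the canonical block name demanded by [wfp]. *)
Definition klab (l : seq nat) : seq nat := [seq index x l | x <- l].

Lemma nth_klab l i : i < size l -> nth 0 (klab l) i = index (nth 0 l i) l.
Proof. by move=> il; rewrite (nth_map 0). Qed.

Lemma wfp_klab (a b : word) : wfp (RawPart (cols a) (cols b) (klab (labs (a ++ b)))).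
Proof.
set s := labs (a ++ b).
rewrite /wfp /= size_map {1}/s !size_map size_cat eqxx /=; apply/allP => i.
rewrite mem_iota add0n /= -{1}(size_cat a b) -{1}(size_map snd (a ++ b)) -/(labs _) -/s => il.
have si : index (nth 0 s i) s < size s by rewrite index_mem mem_nth.
rewrite !nth_klab // nth_index ?mem_nth // eqxx andbT.
by rewrite leqNgt; apply/negP => /(before_find 0); rewrite /= eqxx.
Qed.

(* The partition with rows [a] and [b], whose blocks are the classes of equal labels. *)
Definition mk2 (a b : word) : part := exist _ (RawPart _ _ _) (wfp_klab a b).

Definition plb (a b : word) (x : pt) : nat :=
  match x with U i => nth 0 (labs a) i | L j => nth 0 (labs b) j end.

Definition pvalid (a b : word) (x : pt) : bool :=
  match x with U i => i < size a | L j => j < size b end.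

Lemma valid_mk a b x : valid (mk2 a b) x = pvalid a b x.
Proof. by case: x => i; rewrite /valid /up /lo /= size_map. Qed.

Lemma plb_in a b x : pvalid a b x -> plb a b x \in labs (a ++ b).
Proof.
by case: x => i /= ix; rewrite labs_cat mem_cat mem_nth ?size_map ?orbT.
Qed.

Lemma lab_mk a b x : pvalid a b x -> lab (mk2 a b) x = index (plb a b x) (labs (a ++ b)).
Proof.
rewrite /lab /idx /up /lo /= size_map; case: x => i /= ix.
  rewrite nth_klab; first by rewrite labs_cat nth_cat size_map ix.
  by rewrite size_map size_cat ltn_addr.
rewrite nth_klab ?size_map ?size_cat ?ltn_add2l //.
by rewrite labs_cat nth_cat size_map ltnNge leq_addr /= addKn.
Qed.

Lemma sameblock_mk a b x y : sameblock (mk2 a b) x y <->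
  [/\ pvalid a b x, pvalid a b y & plb a b x = plb a b y].
Proof.
rewrite /sameblock !valid_mk; split=> [[vx [vy]]|[vx vy E]].
  rewrite !lab_mk // => E; split=> //.
  by rewrite -(nth_index 0 (plb_in vx)) E nth_index // plb_in.
by split=> //; split=> //; rewrite !lab_mk // E.
Qed.

Definition pt_of (p : part) (i : nat) : pt :=
  if i < size (up p) then U i else L (i - size (up p)).

Lemma size_rlab (p : part) : size (rlab (val p)) = size (up p) + size (lo p).
Proof. by have /andP [/eqP] := valP p. Qed.

Lemma rlab_le (p : part) i : i < size (rlab (val p)) ->
  nth 0 (rlab (val p)) i <= i /\
  nth 0 (rlab (val p)) (nth 0 (rlab (val p)) i) = nth 0 (rlab (val p)) i.
Proof.
have /andP [_ /allP H] := valP p => ip.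
by have := H i; rewrite mem_iota add0n => /(_ ip) /andP [-> /eqP].
Qed.

Lemma valid_pt_of p i : valid p (pt_of p i) = (i < size (rlab (val p))).
Proof.
rewrite size_rlab /pt_of; case: ltnP => [ip|pi] /=.
  by rewrite /valid ip ltn_addr.
by rewrite /valid ltn_subLR.
Qed.

Lemma lab_pt_of p i : lab p (pt_of p i) = nth 0 (rlab (val p)) i.
Proof. by rewrite /lab /pt_of; case: ltnP => //= pi; rewrite subnKC. Qed.

(** Canonical labels are least indices in their blocks, so each of the two labellings bounds the
    other. *)
Lemma part_ext p q : up p = up q -> lo p = lo q ->
  (forall x y, sameblock p x y <-> sameblock q x y) -> p = q.
Proof.
move=> eu el es; apply: val_inj.
have le (p1 q1 : part) : up p1 = up q1 -> lo p1 = lo q1 ->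
    (forall x y, sameblock p1 x y -> sameblock q1 x y) ->
    forall i, i < size (rlab (val p1)) -> nth 0 (rlab (val q1)) i <= nth 0 (rlab (val p1)) i.
  move=> eu1 el1 es1 i ip; have [li ki] := rlab_le ip.
  have kp := leq_ltn_trans li ip.
  have : sameblock p1 (pt_of p1 i) (pt_of p1 (nth 0 (rlab (val p1)) i)).
    by split; rewrite ?valid_pt_of //; split; rewrite ?valid_pt_of // !lab_pt_of.
  case/es1 => _ [_]; rewrite /pt_of eu1 -!/(pt_of q1 _) !lab_pt_of => ->.
  by apply: (rlab_le _).1; rewrite size_rlab -eu1 -el1 -size_rlab.
have sr : size (rlab (val p)) = size (rlab (val q)) by rewrite !size_rlab eu el.
have er : rlab (val p) = rlab (val q).
  apply: (@eq_from_nth _ 0) => // i ip; apply/eqP; rewrite eqn_leq.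
  rewrite (le q p) ?(le p q) //; try by move=> x y /es.
  by rewrite -sr.
move: eu el er; rewrite /up /lo; case: (val p) (val q) => [u l r] [u' l' r'] /=.
by move=> -> -> ->.
Qed.

Lemma mk2_ren (f : nat -> nat) a b : {in labs (a ++ b) &, injective f} ->
  mk2 (ren f a) (ren f b) = mk2 a b.
Proof.
move=> fi; apply: part_ext; rewrite /up /lo /= ?cols_ren // => x y.
have pv z : pvalid (ren f a) (ren f b) z = pvalid a b z.
  by case: z => i /=; rewrite size_ren.
have pl z : pvalid a b z -> plb (ren f a) (ren f b) z = f (plb a b z).
  by case: z => i /= iz; rewrite labs_ren (nth_map 0) ?size_map.
rewrite !sameblock_mk !pv; split=> [[vx vy]|[vx vy E]]; last by rewrite !pl ?E.
by rewrite !pl // => E; split=> //; apply: fi; rewrite ?plb_in.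
Qed.

Definition urow (p : part) : word := zip (up p) (take (size (up p)) (rlab (val p))).
Definition lrow (p : part) : word := zip (lo p) (drop (size (up p)) (rlab (val p))).

Lemma size_take_rlab p : size (take (size (up p)) (rlab (val p))) = size (up p).
Proof. by rewrite size_takel // size_rlab leq_addr. Qed.

Lemma size_drop_rlab p : size (drop (size (up p)) (rlab (val p))) = size (lo p).
Proof. by rewrite size_drop size_rlab addKn. Qed.

Lemma mk2_rows p : mk2 (urow p) (lrow p) = p.
Proof.
have lu : labs (urow p) = take (size (up p)) (rlab (val p)).
  by apply: unzip2_zip; rewrite size_take_rlab.
have ll : labs (lrow p) = drop (size (up p)) (rlab (val p)).
  by apply: unzip2_zip; rewrite size_drop_rlab.
have cu : cols (urow p) = up p by apply: unzip1_zip; rewrite size_take_rlab.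
have cl : cols (lrow p) = lo p by apply: unzip1_zip; rewrite size_drop_rlab.
apply: part_ext; rewrite /up /lo /= ?cu ?cl // => x y.
have pv z : pvalid (urow p) (lrow p) z = valid p z.
  by case: z => i /=; rewrite -(size_map fst) -/(cols _) ?cu ?cl.
have pl z : valid p z -> plb (urow p) (lrow p) z = lab p z.
  case: z => i /= iz; rewrite ?lu ?ll /lab /=; first by rewrite nth_take.
  by rewrite nth_drop.
rewrite sameblock_mk !pv; split=> [[vx vy]|[vx [vy E]]]; last by split; rewrite ?pl.
by rewrite !pl.
Qed.

(** The cyclic word of [p]; for rows [a] and [b] it is [b ++ winv a] up to renaming. *)
Definition rho (p : part) : word := [seq (ncol p t, plab p t) | t <- iota 0 (npts p)].

Lemma rho_mk a b :
  rho (mk2 a b) = ren (fun l => index l (labs (a ++ b))) (b ++ winv a).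
Proof.
have np : npts (mk2 a b) = size a + size b by rewrite /npts /up /lo /= !size_map.
apply: (@eq_from_nth _ (false, 0)).
  by rewrite size_map size_iota np size_ren size_cat size_inv addnC.
move=> t; rewrite size_map size_iota np => tn.
rewrite (nth_map 0) ?size_iota ?np // nth_iota ?np // add0n.
rewrite nth_ren ?size_cat ?size_inv 1?addnC // nth_cat.
rewrite /plab /ncol /ptat /lo /up /= !size_map.
case: ltnP => tb.
  by rewrite lab_mk //= /color /lo /= !cols_nth (nth_map (false, 0)).
set i := (size a).-1 - (t - size b).
have ta : t - size b < size a by rewrite ltn_subLR // addnC.
have ia : i < size a.
  by rewrite /i; apply: leq_ltn_trans (leq_subr _ _) _; rewrite ltn_predL (leq_ltn_trans _ ta).
rewrite lab_mk //= /color /up /= cols_nth (nth_map (false, 0)) //.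
rewrite /winv nth_rev ?size_map // (nth_map (false, 0)); last by rewrite -subSn // subSS leq_subr.
by have -> : size a - (t - size b).+1 = i by rewrite /i -subn1 -subnDA add1n.
Qed.

Lemma w_rho W (HW : wclass W) a b : W (rho (mk2 a b)) <-> W (b ++ winv a).
Proof.
have H : {in labs (b ++ winv a) &, injective (fun l => index l (labs (a ++ b)))}.
  have sub l : l \in labs (b ++ winv a) -> l \in labs (a ++ b).
    by rewrite !labs_cat !mem_cat mem_labs_inv orbC.
  by move=> l l' /sub la /sub la' E; rewrite -(nth_index 0 la) E nth_index.
rewrite rho_mk; split=> [Wr|]; last exact: (w_ren HW).
have -> : b ++ winv a = ren id (b ++ winv a) by rewrite ren_id_in.
apply: (w_ker HW) Wr => l l' la la'; split=> [|->//]; exact: H.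
Qed.

(** * Category operations on labelled rows *)

Lemma has_blocks_uniq q q' R : up q = up q' -> lo q = lo q' ->
  has_blocks q R -> has_blocks q' R -> q = q'.
Proof.
move=> eu el H H'; apply: part_ext => // x y; rewrite H H'.
by rewrite /valid eu el.
Qed.

Lemma is_tensor_uniq p p' q q' : is_tensor p p' q -> is_tensor p p' q' -> q = q'.
Proof.
by move=> [u [l b]] [u' [l' b']]; apply: has_blocks_uniq b b'; rewrite ?u ?l.
Qed.

Lemma is_inv_uniq p q q' : is_inv p q -> is_inv p q' -> q = q'.
Proof.
by move=> [u [l b]] [u' [l' b']]; apply: has_blocks_uniq b b'; rewrite ?u ?l.
Qed.

Lemma is_comp_uniq p p' q q' : is_comp p p' q -> is_comp p p' q' -> q = q'.
Proof.
by move=> [_ [u [l b]]] [_ [u' [l' b']]]; apply: has_blocks_uniq b b'; rewrite ?u ?l.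
Qed.

Lemma tensor_mk a b a' b' :
  (forall l, l \in labs (a ++ b) -> l \notin labs (a' ++ b')) ->
  is_tensor (mk2 a b) (mk2 a' b') (mk2 (a ++ a') (b ++ b')).
Proof.
move=> dis; rewrite /is_tensor /up /lo /= !cols_cat; split=> //; split=> // x y.
rewrite sameblock_mk !valid_mk.
have sd z : pvalid (a ++ a') (b ++ b') z -> exists z',
    (tside (mk2 a b) z = (false, z') /\ pvalid a b z' /\
      plb (a ++ a') (b ++ b') z = plb a b z') \/
    (tside (mk2 a b) z = (true, z') /\ pvalid a' b' z' /\
      plb (a ++ a') (b ++ b') z = plb a' b' z').
  case: z => i; rewrite /= /up /lo /= size_map size_cat labs_cat nth_cat size_map => iz.
    case: ltnP => ia; first by exists (U i); left.
    by exists (U (i - size a)); right; do 2!split=> //=; rewrite ltn_subLR.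
  case: ltnP => ia; first by exists (L i); left.
  by exists (L (i - size b)); right; do 2!split=> //=; rewrite ltn_subLR.
have ne z z' : pvalid a b z -> pvalid a' b' z' -> plb a b z <> plb a' b' z'.
  by move=> /plb_in/dis/negP nz /plb_in vz' E; apply: nz; rewrite E.
split=> [[vx vy]|[vx [vy]]]; have [x' Hx] := sd _ vx; have [y' Hy] := sd _ vy.
  move=> E; split=> //; split=> //; move: Hx Hy.
  move=> [[-> [px Ex]]|[-> [px Ex]]] [[-> [py Ey]]|[-> [py Ey]]] /=; rewrite Ex Ey in E.
  - by split=> //; apply/sameblock_mk.
  - by case: (ne _ _ px py).
  - by case: (ne _ _ py px).
  - by split=> //; apply/sameblock_mk.
move: Hx Hy => [[-> [px Ex]]|[-> [px Ex]]] [[-> [py Ey]]|[-> [py Ey]]] /= [] // _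
  /sameblock_mk [_ _ E]; split=> //; by rewrite Ex Ey.
Qed.

Lemma inv_mk a b : is_inv (mk2 a b) (mk2 b a).
Proof.
split=> //; split=> // x y; rewrite !sameblock_mk !valid_mk.
have sw z : pvalid a b (swap z) = pvalid b a z by case: z.
have sp z : plb a b (swap z) = plb b a z by case: z.
by rewrite !sw !sp; split=> [[vx vy E]|[vx [vy []]]].
Qed.

Lemma cedge_top p p' x y : cedge p p' (Top x) (Top y) = sameblock p' x y.
Proof. by case: x; case: y. Qed.

Lemma cedge_bot p p' x y : cedge p p' (Bot x) (Bot y) = sameblock p x y.
Proof. by case: x; case: y. Qed.

Definition sumf (F1 F2 : nat -> nat) (s : nat + nat) : nat :=
  match s with inl l => F1 l | inr l => F2 l end.

(** The quantifier over [E] says that [F1] and [F2] identify labels only as far as the gluing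
    forces, in the form supplied by [w_zip]. The sum type keeps the labels of the two factors
    apart. *)
Lemma comp_mk a b b' c (F1 F2 : nat -> nat) :
  cols b = cols b' -> map F1 (labs b) = map F2 (labs b') ->
  (forall E : nat + nat -> nat + nat -> Prop,
    (forall s, E s s) -> (forall s t, E s t -> E t s) ->
    (forall r s t, E r s -> E s t -> E r t) ->
    (forall k, k < size b -> E (inl (nth 0 (labs b) k)) (inr (nth 0 (labs b') k))) ->
    let occ s := match s with inl l => l \in labs (a ++ b) | inr l => l \in labs (b' ++ c) end in
    forall s t, occ s -> occ t -> sumf F1 F2 s = sumf F1 F2 t -> E s t) ->
  is_comp (mk2 b' c) (mk2 a b) (mk2 (ren F1 a) (ren F2 c)).
Proof.
move=> cb Fb H; rewrite /is_comp /up /lo /= !cols_ren; do 3!split=> //.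
have sb : size b' = size b by rewrite -(size_map fst b) -(size_map fst b') -!/(cols _) cb.
pose tag v := match v with Top x => inl (plb a b x) | Bot x => inr (plb b' c x) end.
pose cv v := match v with Top x => pvalid a b x | Bot x => pvalid b' c x end.
pose ce := cedge (mk2 b' c) (mk2 a b).
have Fk k : k < size b -> F1 (nth 0 (labs b) k) = F2 (nth 0 (labs b') k).
  by move=> kb; rewrite -!(nth_map 0 0) ?size_map ?sb // Fb.
have ceF v w : ce v w -> sumf F1 F2 (tag v) = sumf F1 F2 (tag w).
  rewrite /ce; case: v w => [x|x] [y|y].
  - by rewrite cedge_top => /sameblock_mk [_ _ /= ->].
  - by case: x y => i [] j //= [<-]; rewrite /lo /= size_map => /Fk.
  - by case: x y => i [] j //= [<-]; rewrite /up /= size_map sb => /Fk.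
  - by rewrite cedge_bot => /sameblock_mk [_ _ /= ->].
have ctF v w : clos_refl_trans cpt ce v w -> sumf F1 F2 (tag v) = sumf F1 F2 (tag w).
  by elim=> [? ? /ceF //|//|? ? ? _ -> _ ->].
have ctS v w : clos_refl_trans cpt ce v w -> clos_refl_trans cpt ce w v.
  have ceS v0 w0 : ce v0 w0 -> ce w0 v0.
    rewrite /ce; case: v0 w0 => [x|x] [y|y].
    - by rewrite !cedge_top => /sameblock_mk [? ? E]; apply/sameblock_mk.
    - by case: x y => i [] j //= [<-]; rewrite /lo /up /= !size_map sb.
    - by case: x y => i [] j //= [<-]; rewrite /lo /up /= !size_map sb.
    - by rewrite !cedge_bot => /sameblock_mk [? ? E]; apply/sameblock_mk.
  elim=> [x y xy|x|x y z _ Hxy _ Hyz]; [exact/rt_step/ceS | exact: rt_refl |].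
  exact: rt_trans Hyz Hxy.
have ceT v w : cv v -> cv w -> tag v = tag w -> ce v w.
  by rewrite /ce; case: v w => [x|x] [y|y] vx vy;
    rewrite ?cedge_top ?cedge_bot => // -[E]; apply/sameblock_mk.
(* Connectedness in the graph of the composition, passed on to labels. The first disjunct gives
   reflexivity for labels without points. *)
pose E s t := s = t \/ exists v w,
  [/\ cv v, cv w, tag v = s, tag w = t & clos_refl_trans cpt ce v w].
have EE s t : match s with inl l => l \in labs (a ++ b) | inr l => l \in labs (b' ++ c) end ->
    match t with inl l => l \in labs (a ++ b) | inr l => l \in labs (b' ++ c) end ->
    sumf F1 F2 s = sumf F1 F2 t -> E s t.
  move: s t; apply: (H E).
  - by move=> s; left.
  - move=> s t [->|[v [w [cvv cw <- <- vw]]]]; [by left | right].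
    by exists w, v; split=> //; exact: ctS.
  - move=> r s t [->//|[v [w [cvv cw <- <- vw]]]] [<-|[v' [w' [cv' cw' e <- vw']]]].
      by right; exists v, w.
    right; exists v, w'; split=> //; apply: rt_trans vw _; apply: rt_trans _ vw'.
    by apply: rt_step; apply: ceT.
  - move=> k kb; right; exists (Top (L k)), (Bot (U k)); split=> //=; rewrite ?sb //.
    by apply: rt_step; rewrite /ce /= /lo /= size_map.
move=> x y; rewrite sameblock_mk !valid_mk.
have pv z : pvalid (ren F1 a) (ren F2 c) z = cv (cemb z).
  by case: z => i /=; rewrite size_ren.
have pl z : cv (cemb z) -> plb (ren F1 a) (ren F2 c) z = sumf F1 F2 (tag (cemb z)).
  by case: z => i /= iz; rewrite labs_ren (nth_map 0) ?size_map.
rewrite !pv; split=> [[vx vy]|[vx [vy /ctF e]]]; last by split; rewrite ?pl.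
rewrite !pl // => e; split=> //; split=> //.
have occ z : cv (cemb z) -> match tag (cemb z) with
    inl l => l \in labs (a ++ b) | inr l => l \in labs (b' ++ c) end.
  case: z => i /= iz; first exact: (@plb_in a b (U i)).
  exact: (@plb_in b' c (L i)).
case: (EE _ _ (occ _ vx) (occ _ vy) e) => [e'|[v [w [cvv cw tv tw vw]]]].
  by apply: rt_step; apply: ceT.
apply: (@rt_trans _ _ _ v); first by apply: rt_step; apply: ceT.
by apply: rt_trans vw _; apply: rt_step; apply: ceT.
Qed.

Lemma mk2_disjoint p p' : exists a b a' b',
  [/\ p = mk2 a b, p' = mk2 a' b' &
    forall l, l \in labs (a ++ b) -> l \notin labs (a' ++ b')].
Proof.
set a := urow p; set b := lrow p; pose sh l := l + fresh (a ++ b).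
exists a, b, (ren sh (urow p')), (ren sh (lrow p')); split.
- by rewrite mk2_rows.
- by rewrite mk2_ren ?mk2_rows // => l m _ _ /addIn.
move=> l /freshP lK; apply/negP; rewrite -ren_cat labs_ren => /mapP [m _ E].
by move: lK; rewrite E ltnNge leq_addl.
Qed.

Lemma category_of_wclass W : wclass W -> category (fun p => W (rho p)).
Proof.
move=> HW; split; first by move=> c; exact: (w_base HW c 0).
split; first by move=> c; exact: (w_base HW c 0).
split; [|split].
- move=> p p' q; have [a [b [a' [b' [-> -> dis]]]]] := mk2_disjoint p p'.
  move=> /(w_rho HW) W1 /(w_rho HW) W2 /(is_tensor_uniq (tensor_mk dis)) <-.
  (* The cyclic word of a tensor product is one word inserted into the other. *)
  apply/(w_rho HW); rewrite inv_cat -catA [b' ++ _]catA.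
  apply: (w_insert_word HW) => // l; rewrite labs_cat mem_cat mem_labs_inv orbC.
  by rewrite -mem_cat -labs_cat => /dis; rewrite !labs_cat !mem_cat mem_labs_inv orbC.
- move=> p p' q; have [b' [c [a [b [-> -> dis]]]]] := mk2_disjoint p p'.
  move=> /(w_rho HW) W1 /(w_rho HW) W2 Hq.
  have cb : cols b = cols b' by case: Hq.
  have sb : size b = size b' by rewrite -(size_map fst b) -(size_map fst b') -!/(cols _) cb.
  (* Side by side, the two cyclic words have their middle rows facing each other, ready to be
     zipped. *)
  have : W (c ++ winv b' ++ winv (winv b) ++ winv a).
    rewrite invK catA; apply: (w_cat HW) => // l.
    rewrite labs_cat mem_cat mem_labs_inv orbC -mem_cat -labs_cat => /dis.
    by rewrite !labs_cat !mem_cat mem_labs_inv orbC.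
  case/(w_zip HW); first by rewrite !cols_inv cb.
  move=> G [WG GB GE].
  have Hc : is_comp (mk2 b' c) (mk2 a b) (mk2 (ren G a) (ren G c)).
    apply: comp_mk => //.
      by move: GB; rewrite !labs_inv !map_rev => /(can_inj revK).
    move=> E Er Es Et Ep occ s t os ot EG.
    (* The factors have disjoint labels, so a label reveals the factor from which it comes. *)
    pose tg l : nat + nat := if l \in labs (b' ++ c) then inr l else inl l.
    have tgE u : occ u -> u = tg (sumf id id u).
      case: u => l /= lo; rewrite /tg; last by rewrite lo.
      by case: ifP => // /dis; rewrite lo.
    rewrite (tgE _ os) (tgE _ ot).
    apply: (GE (fun l m => E (tg l) (tg m))); try by move=> *; eauto.
      move=> k; rewrite size_inv => kb; rewrite !labs_inv !nth_rev ?size_map ?sb //.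
      set j := _ - k.+1; have jb : j < size b by rewrite sb /j -subSn // subSS leq_subr.
      have <- : inr (nth 0 (labs b') j) = tg (nth 0 (labs b') j).
        by rewrite /tg labs_cat mem_cat mem_nth // size_map -sb.
      have <- : inl (nth 0 (labs b) j) = tg (nth 0 (labs b) j).
        rewrite /tg; case: ifP => // /dis.
        by rewrite labs_cat mem_cat mem_nth ?orbT // size_map.
      by apply: (Es _ _); apply: Ep.
    by case: (s) (t) EG => [l|l] [m|m].
  rewrite (is_comp_uniq Hq Hc); apply/(w_rho HW).
  by rewrite -ren_inv.
- move=> p q; rewrite -(mk2_rows p) => /(w_rho HW) W1 /(is_inv_uniq (inv_mk _ _)) <-.
  by apply/(w_rho HW); move: (w_inv HW W1); rewrite inv_cat invK.
Qed.

(** * The class of words of a category *)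

Lemma cat_id C (HC : category C) c x : C (mk2 [:: (c, x)] [:: (c, x)]).
Proof.
case: HC => /(_ c) + _; suff -> : idp c = mk2 [:: (c, x)] [:: (c, x)] by [].
by apply: val_inj; rewrite /= /klab /= eqxx.
Qed.

Lemma cat_pair C (HC : category C) c x : C (mk2 [::] [:: (c, x); (~~ c, x)]).
Proof.
case: HC => _ [/(_ c) + _].
suff -> : pairp c = mk2 [::] [:: (c, x); (~~ c, x)] by [].
by apply: val_inj; rewrite /= /klab /= eqxx.
Qed.

Lemma cat_inv C (HC : category C) a b : C (mk2 a b) -> C (mk2 b a).
Proof. by case: HC => _ [_ [_ [_ H]]] /H; apply; exact: inv_mk. Qed.

Lemma cat_tensor C (HC : category C) a b a' b' :
  (forall l, l \in labs (a ++ b) -> l \notin labs (a' ++ b')) ->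
  C (mk2 a b) -> C (mk2 a' b') -> C (mk2 (a ++ a') (b ++ b')).
Proof.
by case: HC => _ [_ [H _]] dis Cp Cp'; apply: H Cp Cp' _; exact: tensor_mk.
Qed.

(** Composing a pair with its involution leaves only a closed loop, which is discarded. *)
Lemma cat_nil C (HC : category C) : C (mk2 [::] [::]).
Proof.
have Cp := cat_pair HC false 0; have Ci := cat_inv HC Cp.
case: HC => _ [_ [_ [H _]]]; apply: (H _ _ _ Ci Cp).
apply: (comp_mk (F1 := id) (F2 := id)) => // E Er Es _ /(_ 0 isT) /= E0.
by move=> [l|l] [m|m]; rewrite !inE !orbb => /eqP-> /eqP-> _; auto.
Qed.

Lemma cat_ids C (HC : category C) s : uniq (labs s) -> C (mk2 s s).
Proof.
elim: s => [_|[c x] s IH /andP [xs us]]; first exact: cat_nil.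
apply: (cat_tensor HC (a := [:: (c, x)]) (b := [:: (c, x)])); last exact: IH.
  move=> l; rewrite !inE orbb => /eqP ->; rewrite labs_cat mem_cat orbb; exact: xs.
exact: cat_id.
Qed.

Definition number (n : nat) (cs : seq bool) : word := zip cs (iota n (size cs)).

Lemma cols_number n cs : cols (number n cs) = cs.
Proof. by apply: unzip1_zip; rewrite size_iota. Qed.

Lemma labs_number n cs : labs (number n cs) = iota n (size cs).
Proof. by apply: unzip2_zip; rewrite size_iota. Qed.

(** Composition with a cap flanked by identity strings on both sides. *)
Lemma cat_contract C (HC : category C) a c x y l1 l2 :
  C (mk2 a (l1 ++ (c, x) :: (~~ c, y) :: l2)) ->
  C (mk2 (ren (subst x y) a) (ren (subst x y) (l1 ++ l2))).
Proof.
set b := l1 ++ _ => Cp; pose n := size l1.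
pose i1 := number 0 (cols l1); pose i2 := number n.+1 (cols l2).
have li1 : labs i1 = iota 0 n by rewrite labs_number size_map.
have li2 : labs i2 = iota n.+1 (size l2) by rewrite labs_number size_map.
pose b' := i1 ++ (c, n) :: (~~ c, n) :: i2; pose c' := i1 ++ i2.
have Cq : C (mk2 b' c').
  apply: (@cat_tensor C HC i1 i1 ((c, n) :: (~~ c, n) :: i2) i2); last 1 first.
  - apply: (cat_tensor HC (a := [:: (c, n); (~~ c, n)]) (b := [::])).
    + move=> l; rewrite !inE orbb => /eqP ->.
      by rewrite labs_cat mem_cat orbb li2 mem_iota ltnn.
    + exact: cat_inv (cat_pair HC _ _).
    + by apply: cat_ids => //; rewrite li2 iota_uniq.
  - move=> l; rewrite labs_cat mem_cat orbb li1 mem_iota /= add0n => ln.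
    rewrite !inE !negb_or (ltn_eqF ln) /= labs_cat mem_cat orbb li2 mem_iota.
    by rewrite leqNgt ltnS (ltnW ln).
  - by apply: cat_ids => //; rewrite li1 iota_uniq.
(* [F2] gives the label carried by string [i]; the cap has number [n] and carries the common label
   [x]. *)
pose r := subst x y; pose F2 i := nth 0 (map r (labs l1) ++ x :: map r (labs l2)) i.
have F21 : map F2 (labs i1) = map r (labs l1).
  rewrite li1; apply: (@eq_from_nth _ 0); rewrite !size_map ?size_iota // => i il.
  by rewrite (nth_map 0) ?size_iota // nth_iota // add0n /F2 nth_cat !size_map il.
have F22 : map F2 (labs i2) = map r (labs l2).
  rewrite li2; apply: (@eq_from_nth _ 0); rewrite !size_map ?size_iota // => i il.
  rewrite (nth_map 0) ?size_iota // nth_iota // /F2 nth_cat !size_map -/n.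
  by rewrite ltnNge addSn leqW ?leq_addr //= subSn ?leq_addr // addKn.
have F2n : F2 n = x by rewrite /F2 nth_cat !size_map ltnn subnn.
have rx : r x = x by rewrite /r /subst; case: eqP.
have ry : r y = x by rewrite /r /subst eqxx.
have cb : cols b = cols b' by rewrite /b /b' !cols_cat /= !cols_number.
have Fb : map r (labs b) = map F2 (labs b').
  rewrite /b /b' !labs_cat !labs_cons !map_cat /= -/(labs _) -/(labs _).
  by rewrite -!/(labs _) F21 F22 F2n rx ry.
have sb : size b' = size b by rewrite -(size_map fst b) -(size_map fst b') -!/(cols _) cb.
have -> : ren r (l1 ++ l2) = ren F2 c'.
  have cc : cols (l1 ++ l2) = cols c' by rewrite /c' !cols_cat !cols_number.
  have Fc : map r (labs (l1 ++ l2)) = map F2 (labs c').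
    by rewrite /c' !labs_cat !map_cat F21 F22.
  rewrite -[LHS](@zip_unzip _ _ (ren r (l1 ++ l2))) -[RHS](@zip_unzip _ _ (ren F2 c')).
  rewrite /unzip1 /unzip2 -!/(cols _) -!/(labs _) !cols_ren !labs_ren.
  by rewrite cc Fc.
case: (HC) => _ [_ [_ [H _]]]; apply: (H _ _ _ Cq Cp).
apply: comp_mk => // E Er Es Et Ep occ.
have Exy : E (inl x) (inl y).
  have nb : n < size b by rewrite /b size_cat /= -addSnnS leq_addr.
  have nb1 : n.+1 < size b by rewrite /b size_cat /= !addnS !ltnS leq_addr.
  have := Ep _ nb; have := Ep _ nb1.
  rewrite /b /b' !labs_cat !nth_cat !size_map size_zip size_map size_iota minnn -/n.
  rewrite ltnn subnn ltnNge leqW //= subSnn /= => E1 E2.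
  by apply: Et E2 _; apply: Es.
have Er' l l' : r l = r l' -> E (inl l) (inl l').
  rewrite /r /subst; case: eqP => [->|_]; case: eqP => [->|_] //.
  - by move=> <-; apply: Es.
  - by move=> ->.
  - by move=> ->.
have toL s : occ s -> exists2 l, E s (inl l) & sumf r F2 s = r l.
  case: s => l /= lo; first by exists l.
  have : l \in labs b'.
    apply: sub_labs lo => e; rewrite /b' /c' !(mem_cat, inE).
    by do !case: (_ \in _); do !case: (_ == _).
  case/(nthP 0) => k; rewrite size_map sb => kb <-; exists (nth 0 (labs b) k).
    by apply: Es; exact: Ep.
  by rewrite -!(nth_map 0 0) ?size_map ?sb // Fb.
move=> s t /toL [l sl ->] /toL [m tm ->] /Er' lm.
by apply: (Et _ _ _ sl); apply: (Et _ _ _ lm); apply: Es.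
Qed.

Lemma cat_contract_up C (HC : category C) b c x y l1 l2 :
  C (mk2 (l1 ++ (c, x) :: (~~ c, y) :: l2) b) ->
  C (mk2 (ren (subst x y) (l1 ++ l2)) (ren (subst x y) b)).
Proof. by move=> /(cat_inv HC)/(cat_contract HC)/(cat_inv HC). Qed.

(** A string added on the right is capped off with the last upper point, which bends this point into
    the lower row. *)
Lemma cat_move_down C (HC : category C) a b e :
  C (mk2 (rcons a e) b) -> C (mk2 a (rcons b (flip e))).
Proof.
case: e => c x Cp; pose k := fresh (rcons a (c, x) ++ b).
have kn := fresh_notin (rcons a (c, x) ++ b); rewrite -/k in kn.
have H : C (mk2 (a ++ (c, x) :: (~~ c, k) :: [::]) (b ++ [:: (~~ c, k)])).
  rewrite -cat_rcons cats1 -cats1; apply: (cat_tensor HC) (Cp) (cat_id HC _ _).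
  move=> l; apply: contraL => lk; have -> : l = k by move: lk; rewrite !inE orbb => /eqP.
  exact: kn.
have ka : k \notin labs a.
  by apply: contraNN kn; apply: sub_labs => e; rewrite mem_cat mem_rcons inE => ->; rewrite orbT.
have kb : k \notin labs b.
  by apply: contraNN kn; apply: sub_labs => e; rewrite mem_cat orbC => ->.
move: (cat_contract_up HC H); rewrite cats0 ren_cat ren_cons !ren_subst_id //.
by rewrite /subst eqxx cats1.
Qed.

Lemma cat_move_up C (HC : category C) a b e :
  C (mk2 a (rcons b e)) -> C (mk2 (rcons a (flip e)) b).
Proof. by move=> /(cat_inv HC)/(cat_move_down HC)/(cat_inv HC). Qed.

Lemma cat_one_row C (HC : category C) a b :
  C (mk2 a b) <-> C (mk2 [::] (b ++ winv a)).
Proof.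
elim/last_ind: a b => [|a e IH] b; first by rewrite cats0.
rewrite inv_rcons -cat_rcons -IH; split; first exact: cat_move_down.
by move=> /(cat_move_up HC); rewrite flipK.
Qed.

Lemma wclass_of_category C : category C -> wclass (fun s => C (mk2 [::] s)).
Proof.
move=> HC; split.
- by move=> f s fi; rewrite -[mk2 [::] (ren f s)]/(mk2 (ren f [::]) (ren f s)) mk2_ren.
- case=> c x s Cp; pose k := fresh ((c, x) :: s).
  have kn := fresh_notin ((c, x) :: s); rewrite -/k in kn.
  (* A string added on the left and contracted with the first letter takes it to the upper row, from
     where it bends down on the right. *)
  have H : C (mk2 [:: (~~ c, k)] ([::] ++ (~~ c, k) :: (~~ ~~ c, x) :: s)).
    rewrite negbK; apply: (@cat_tensor C HC [:: (~~ c, k)] [:: (~~ c, k)] [::] ((c, x) :: s)) => //.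
      by move=> l; rewrite !inE orbb => /eqP ->.
    exact: cat_id.
  move: (cat_contract HC H).
  have -> : ren (subst k x) [:: (~~ c, k)] = ren (subst k x) [:: (~~ c, x)].
    by rewrite /ren /= /subst eqxx; case: eqP.
  rewrite mk2_ren => [|]; last exact: subst_inj.
  move/(cat_one_row HC); rewrite /winv /= /flip /= negbK cats1; exact.
- move=> s t dis Cs Ct; exact: (cat_tensor HC (a := [::]) (a' := [::])).
- by move=> c x y s1 s2 /(cat_contract HC).
- by move=> s /(cat_inv HC)/(cat_one_row HC).
- exact: cat_pair.
Qed.

Lemma cat_rho C (HC : category C) p : C p <-> C (mk2 [::] (rho p)).
Proof.
have HW := wclass_of_category HC; rewrite -(mk2_rows p).
by rewrite (w_rho HW) -(cat_one_row HC).
Qed.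

Lemma subseq_nth4 (s : seq nat) i j k l : i < j -> j < k -> k < l -> l < size s ->
  subseq [:: nth 0 s i; nth 0 s j; nth 0 s k; nth 0 s l] s.
Proof.
move=> ij jk kl ls; rewrite -{5}(mkseq_nth 0 s).
apply: (map_subseq (nth 0 s) (s1 := [:: i; j; k; l])).
have -> : [:: i; j; k; l] = [seq t <- iota 0 (size s) | t \in [:: i; j; k; l]].
  apply: (irr_sorted_eq ltn_trans ltnn); first by rewrite /= ij jk kl.
    exact: (sorted_filter ltn_trans _ (iota_ltn_sorted _ _)).
  move=> t; rewrite mem_filter mem_iota add0n /= andbC.
  case: (boolP (t \in _)); rewrite ?andbF // andbT !inE => /or4P [] /eqP ->;
    apply/esym; lia.
exact: filter_subseq.
Qed.

Lemma nth4_subseq (s : seq nat) a b c d : subseq [:: a; b; c; d] s ->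
  exists i j k l, [/\ i < j, j < k, k < l & l < size s] /\
    [/\ nth 0 s i = a, nth 0 s j = b, nth 0 s k = c & nth 0 s l = d].
Proof.
rewrite -{1}(mkseq_nth 0 s) => /subseq_map_inv [t [E st]].
case: t E st => [|i [|j [|k [|l [|? ?]]]]] //= [-> -> -> ->] st.
have := subseq_sorted ltn_trans st (iota_ltn_sorted _ _).
rewrite /= => /and4P [ij jk kl _]; exists i, j, k, l; split=> //; split=> //.
have : l \in iota 0 (size s) by apply: (mem_subseq st); rewrite !inE eqxx !orbT.
by rewrite mem_iota.
Qed.

Lemma walkP lam h s : reflect
  (forall k, k < size s ->
    lam (nth 0 (labs s) k) = lv (h + hsum (take k (cols s)))%R (nth false (cols s) k))
  (walk lam h s).
Proof.
elim: s h => [|e s IH] h /=; first by left.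
apply: (iffP andP) => [[/eqP le /IH H] [|k] /= ks|H].
- by rewrite hsum_nil addr0.
- by rewrite H // hsum_cons addrA.
split; first by have := H 0 isT; rewrite /= hsum_nil addr0 => ->.
by apply/IH => k ks; have := H k.+1 ks; rewrite /= hsum_cons addrA.
Qed.

(** * The sets [I_D] in terms of words *)

(** The height before step [t], with base height zero. *)
Definition hgt (p : part) (t : nat) : int := hsum (take t (cols (rho p))).
Definition lev (p : part) (t : nat) : int := lv (hgt p t) (ncol p t).

Lemma size_rho p : size (rho p) = npts p.
Proof. by rewrite size_map size_iota. Qed.

Lemma nth_rho p t : t < npts p -> nth (false, 0) (rho p) t = (ncol p t, plab p t).
Proof. by move=> tn; rewrite (nth_map 0) ?size_iota // nth_iota. Qed.

Lemma nth_cols_rho p t : t < npts p -> nth false (cols (rho p)) t = ncol p t.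
Proof. by move=> tn; rewrite cols_nth nth_rho. Qed.

Lemma nth_labs_rho p t : t < npts p -> nth 0 (labs (rho p)) t = plab p t.
Proof. by move=> tn; rewrite (nth_map (false, 0)) ?size_rho // nth_rho. Qed.

Lemma hgtS p t : t < npts p -> hgt p t.+1 = (hgt p t + stepv (ncol p t))%R.
Proof.
move=> tn; rewrite /hgt (take_nth false) ?size_map ?size_iota //.
by rewrite -cats1 hsum_cat hsum_cons hsum_nil addr0 nth_cols_rho.
Qed.

Lemma sum_hgt p a b : a <= b -> b <= npts p ->
  (\sum_(a <= t < b) stepv (ncol p t) = hgt p b - hgt p a)%R.
Proof.
move=> ab; elim: b ab => [|b IH].
  by rewrite leqn0 => /eqP -> _; rewrite big_geq // subrr.
rewrite leq_eqVlt => /orP [/eqP <- _|ab bn]; first by rewrite big_geq // subrr.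
by rewrite big_nat_recr //= IH ?(ltnW bn) // hgtS // addrAC.
Qed.

Lemma sum_nat_cond (F : nat -> int) (P : pred nat) (v : bool) a b :
  (forall t, a <= t < b -> P t = v) ->
  (\sum_(a <= t < b | P t) F t = if v then \sum_(a <= t < b) F t else 0)%R.
Proof.
move=> Pv; rewrite big_nat_cond; case: v Pv => Pv.
  rewrite [RHS]big_nat_cond; apply: eq_bigl => t.
  by case: (boolP (a <= t < b)) => // /Pv ->.
by apply: big_pred0 => t; case: (boolP (a <= t < b)) => // /Pv ->.
Qed.

Lemma sigmaE p S : sigma p S = (\sum_(0 <= t < npts p | S t) stepv (ncol p t))%R.
Proof. by rewrite /sigma big_mkord. Qed.

Lemma sigma_open p a b : a < npts p -> b < npts p -> a != b ->
  hgt p (npts p) = 0%R -> sigma p (openI a b) = (hgt p b - hgt p a.+1)%R.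
Proof.
move=> an bn; rewrite neq_ltn sigmaE => /orP [ab|ba] h0.
  rewrite (@big_cat_nat _ _ _ b) //= ?(ltnW bn) // (@big_cat_nat _ _ _ a.+1) //=.
  rewrite (@sum_nat_cond _ _ false 0 a.+1); last first.
    by move=> t; rewrite /openI ab => /andP [_ ta]; rewrite ltnNge -ltnS ta.
  rewrite (@sum_nat_cond _ _ true a.+1 b); last first.
    by move=> t /andP [at' tb]; rewrite /openI ab at' tb.
  rewrite (@sum_nat_cond _ _ false b (npts p)); last first.
    by move=> t /andP [bt tn]; rewrite /openI ab andbC ltnNge bt.
  by rewrite add0r addr0 sum_hgt // ltnW.
(* The interval wraps around position zero; the vanishing total turns its two pieces into one
   difference of heights. *)
have nab : (a < b) = false by rewrite ltnNge (ltnW ba).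
rewrite (@big_cat_nat _ _ _ a.+1) //= (@big_cat_nat _ _ _ b 0 a.+1) //= ?(leqW (ltnW ba)) //.
rewrite (@sum_nat_cond _ _ true 0 b); last first.
  by move=> t /andP [_ tb]; rewrite /openI nab ba tb orbT.
rewrite (@sum_nat_cond _ _ false b a.+1); last first.
  move=> t /andP [bt ta]; rewrite /openI nab ba ltnNge [t < b]ltnNge bt orbF.
  by rewrite -ltnS ta.
rewrite (@sum_nat_cond _ _ true a.+1 (npts p)); last first.
  by move=> t /andP [at' tn]; rewrite /openI nab ba at'.
rewrite addr0 !sum_hgt ?(ltnW bn) // h0 /hgt take0 hsum_nil; lia.
Qed.

Lemma sigma_hopen p a b : a < npts p -> b < npts p -> a != b ->
  sigma p (hoI a b) = (sigma p (openI a b) + stepv (ncol p b))%R.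
Proof.
move=> an bn ab; rewrite /sigma (bigD1 (Ordinal bn)) /=; last first.
  by rewrite /hoI ab eqxx orbT.
rewrite addrC; congr (_ + _)%R; apply: eq_bigl => t; rewrite /hoI ab /= -val_eqE /=.
case: (eqVneq (t : nat) b) => [->|_]; last by rewrite orbF andbT.
by rewrite andbF /openI ltnn andbF; case: ltnP => //; case: ltnP => //; rewrite ?(eq_sym b) ?ltnn; lia.
Qed.

(** An open interval contributes the height before [b] minus the height after [a]. Adding the
    endpoint for equal colours, as [delta] does, makes this the difference of levels for all choices
    of colours. *)
Lemma deltaE p a b : a < npts p -> b < npts p -> a != b ->
  hgt p (npts p) = 0%R -> delta p a b = (lev p b - lev p a)%R.
Proof.
move=> an bn ab h0; rewrite /delta sigma_hopen // sigma_open // hgtS // /lev /lv.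
by case: (ncol p a) (ncol p b) => [] [] /=; lia.
Qed.

Lemma count_plab p l :
  count (fun u => plab p u == l) (iota 0 (npts p)) =
  count_mem (false, l) (rho p) + count_mem (true, l) (rho p).
Proof.
rewrite /rho !count_map; elim: (iota _ _) => //= u s ->; rewrite addnACA.
by congr addn; rewrite !xpair_eqE; case: (ncol p u); rewrite ?addn0.
Qed.

(** A block with one point of each normalized colour is a letter and its flip, each occurring
    once. *)
Lemma P2nb_rho p : P2nb p <-> uniq (rho p) /\ flip_closed (rho p).
Proof.
split=> [[c2 nc]|[ur fr]].
  have ur : uniq (rho p).
    rewrite map_inj_in_uniq ?iota_uniq // => u v.
    rewrite !mem_iota !add0n /= => un vn [E1 E2].
    apply/eqP; apply/negPn/negP => uv; have := nc u v un vn uv E2.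
    by rewrite E1 eqxx.
  split=> // e /mapP [t]; rewrite mem_iota add0n => /= tn ->.
  have := c2 t tn; rewrite count_plab !count_uniq_mem // /flip /=.
  by case: (ncol p t) => /=; do 2!case: (_ \in _).
split=> [t tn|u v un vn uv E].
  rewrite count_plab !count_uniq_mem //.
  have tw : (ncol p t, plab p t) \in rho p by apply: map_f; rewrite mem_iota.
  have := fr _ tw; rewrite /flip /=; case: (ncol p t) tw => /= -> -> //.
apply/eqP => En; move: uv; rewrite -(nth_uniq (false, 0) _ _ ur) ?size_rho //.
by rewrite !nth_rho // E En eqxx.
Qed.

Lemma hgt_end p : uniq (rho p) -> flip_closed (rho p) -> hgt p (npts p) = 0%R.
Proof.
move=> ur fr; rewrite /hgt take_oversize ?hsum_flip_closed //.
by rewrite size_map size_rho.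
Qed.

Lemma I_rho D p : I_ D p <-> IW D (rho p).
Proof.
split=> [[[/P2nb_rho [ur fr] s0] cr]|[ur fr [lam [h [/walkP ww cs]]]]].
  have h0 := hgt_end ur fr; split=> //.
  (* The level of the first point of the block; by [S0] and [deltaE] the other point has the same
     level. *)
  pose lam l := lev p (index l (labs (rho p))).
  have lamE t : t < npts p -> lam (plab p t) = lev p t.
    move=> tn; rewrite /lam; set t0 := index _ _.
    have lt : plab p t \in labs (rho p).
      by rewrite -(nth_labs_rho tn) mem_nth // size_map size_rho.
    have t0n : t0 < npts p by rewrite -size_rho -(size_map snd) index_mem.
    have E : plab p t0 = plab p t by rewrite -nth_labs_rho // nth_index.
    have [-> //|ne] := eqVneq t0 t.
    have nE : ncol p t0 != ncol p t.
      have [_ nc] : P2nb p by apply/P2nb_rho.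
      exact: nc.
    have := deltaE t0n tn ne h0; rewrite /delta nE s0 //; lia.
  exists lam, 0%R; split.
    apply/walkP => k; rewrite size_rho => kn.
    by rewrite nth_labs_rho // lamE // add0r nth_cols_rho.
  move=> x y xy /nth4_subseq [i [j [k [l [[ij jk kl ln] [ei ej ek el]]]]]].
  have ln' : l < npts p by rewrite -size_rho -(size_map snd).
  have kn := ltn_trans kl ln'; have jn := ltn_trans jk kn; have in' := ltn_trans ij jn.
  rewrite nth_labs_rho // in ei; rewrite nth_labs_rho // in ej.
  rewrite nth_labs_rho // in ek; rewrite nth_labs_rho // in el.
  have ik := ltn_trans ij jk.
  have := cr i k j l in' kn jn ln'; rewrite ei ek ej el => /(_ erefl erefl xy).
  rewrite neq_ltn ik /openI ik ij jk kl /= [k < i]ltnNge (ltnW ik) /= => /(_ isT isT isT).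
  rewrite deltaE // ?neq_ltn ?ij // -(lamE i) // -(lamE j) // ei ej.
  by rewrite -abszN opprB.
have h0 := hgt_end ur fr.
have lamE t : t < npts p -> lam (plab p t) = (h + lev p t)%R.
  move=> tn; have := ww t; rewrite size_rho nth_labs_rho // nth_cols_rho // => /(_ tn) ->.
  by rewrite /lev /lv /hgt; case: (ncol p t); lia.
have P2 : P2nb p by apply/P2nb_rho.
have dE a b : a < npts p -> b < npts p -> a != b ->
    delta p a b = (lam (plab p b) - lam (plab p a))%R.
  by move=> an bn ab; rewrite deltaE // !lamE //; lia.
split.
  split=> // a b an bn ab E; have := dE a b an bn ab.
  rewrite /delta; have [_ nc] := P2; rewrite (nc a b an bn ab E) => ->.
  by rewrite E subrr.
move=> a b c d an bn cn dn Eab Ecd nac ab ac bd.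
have ac' : a != c by apply: contraNneq nac => ->.
rewrite dE //; set x := plab p a; set y := plab p c.
have key i j k l : i < j -> j < k -> k < l -> l < npts p ->
    subseq [:: plab p i; plab p j; plab p k; plab p l] (labs (rho p)).
  move=> ij jk kl ln; have kn := ltn_trans kl ln.
  have jn := ltn_trans jk kn; have in' := ltn_trans ij jn.
  rewrite -(nth_labs_rho in') -(nth_labs_rho jn) -(nth_labs_rho kn) -(nth_labs_rho ln).
  by apply: subseq_nth4; rewrite // size_map size_rho.
suff [S|S] : subseq [:: x; y; x; y] (labs (rho p)) \/ subseq [:: y; x; y; x] (labs (rho p)).
  by have := cs x y nac S; rewrite -abszN opprB.
  by apply: cs => //; rewrite eq_sym.
(* Cut at position zero, the cyclic order a, c, b, d becomes one of four linear orders, in each of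
   which [x] and [y] alternate. *)
move: ac bd; rewrite /openI; move: ab; rewrite neq_ltn => /orP [ab|ba].
  rewrite ab [b < a]ltnNge (ltnW ab) /= => /andP [ac cb] /orP [bd|da].
    by left; rewrite {2}/x Eab {2}/y Ecd; apply: key.
  by right; rewrite {1}/y Ecd {2}/x Eab; apply: key.
rewrite ba [a < b]ltnNge (ltnW ba) /= => /orP [ac|cb] /andP [bd da].
  by left; rewrite {1}/x Eab {1}/y Ecd; apply: key.
by right; rewrite {2}/y Ecd {1}/x Eab; apply: key.
Qed.

(** * Generated categories and the classification *)

Lemma gen_category G : category (gen G).
Proof.
split; first by move=> c C [H _] _; exact: H.
split; first by move=> c C [_ [H _]] _; exact: H.
split; [|split].
- move=> p p' q gp gp' t C HC GC; have [_ [_ [H _]]] := HC.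
  by apply: (H p p') => //; [exact: gp | exact: gp'].
- move=> p p' q gp gp' t C HC GC; have [_ [_ [_ [H _]]]] := HC.
  by apply: (H p p') => //; [exact: gp | exact: gp'].
- move=> p q gp t C HC GC; have [_ [_ [_ [_ H]]]] := HC.
  by apply: (H p) => //; exact: gp.
Qed.

Lemma I_sub D D' p : (forall n, D' n -> D n) -> I_ D p -> I_ D' p.
Proof. by move=> DD /I_rho /(IW_sub DD) /I_rho. Qed.

(** [IW] for the full set is a class of words, so it defines a category, which contains the smallest
    one. *)
Lemma gen_I_ p : gen (fun _ => False) p -> I_ (fun _ => True) p.
Proof.
move=> gp; apply/I_rho.
exact: (gp _ (category_of_wclass (IW_wclass (fun _ => True)))).
Qed.

Theorem theorem2 :
  (forall C : part -> Prop,
     category C ->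
     (forall p, gen (fun _ => False) p -> C p) ->
     (forall p, C p -> I_ (fun _ => False) p) ->
     exists D : nat -> Prop, subsemigroup D /\ (forall p, C p <-> I_ D p))
  /\ (forall p, gen (fun _ => False) p <-> I_ (fun _ => True) p).
Proof.
have wordI C : category C -> (forall p, C p -> I_ (fun _ => False) p) ->
    forall s, C (mk2 [::] s) -> IW (fun _ => False) s.
  move=> HC CI s /CI /I_rho /(w_rho (IW_wclass _)).
  by rewrite /winv /= cats0.
split=> [C HC _ CI|p].
  pose W s := C (mk2 [::] s).
  have HW : wclass W := wclass_of_category HC.
  have WI : forall s, W s -> IW (fun _ => False) s := wordI C HC CI.
  exists (fun n => ~ dist W n); split.
    by move=> a b na nb /(dist_split HW WI) [].
  move=> p; rewrite (cat_rho HC) I_rho; split; last exact: (IW_generated HW WI).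
  (* Every crossing in a member of [C] witnesses that its distance occurs. *)
  move=> Wp; have [us fs [lam [h [ww _]]]] := WI _ Wp.
  split=> //; exists lam, h; split=> // x y xy sub; apply; by exists (rho p), lam, h, x, y.
split; first exact: gen_I_.
have HC := gen_category (fun _ => False).
have CI q : gen (fun _ => False) q -> I_ (fun _ => False) q.
  by move=> /gen_I_; exact: I_sub.
pose W s := gen (fun _ => False) (mk2 [::] s).
have HW : wclass W := wclass_of_category HC.
rewrite (cat_rho HC) => /I_rho Ip; apply: (IW_generated HW (wordI _ HC CI)).
(* [p] avoids all distances at its crossings, in particular those that do not occur in the generated
   category. *)
exact: IW_sub Ip.
Qed.
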